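(* Let $I$ be a non-empty open interval of $\mathbb{R}$, let $\lambda_1,\lambda_2$ be probability measures on $\mathcal{B}_I$ of finite mean which are in convex order, and let $f:I\to\mathbb{R}$ be concave with $\int f^-\,d\lambda_2<\infty$. Assume the support of $\lambda_1$ is the finite set $\{a_1,\ldots,a_n\}$ of cardinality $n\in\mathbb{N}$. Let $\mathcal{M}$ be the set of martingale transports of $\lambda_1$ to $\lambda_2$, let $\mathcal{C}\subset\mathcal{M}$ be the set of curtain martingale transports of $\lambda_1$ to $\lambda_2$ and, for $\nu\in\mathcal{M}$ and $i\in\{1,\ldots,n\}$, let $\nu_i:=\nu(X_2\in\cdot\mid X_1=a_i)$. Let $\mathcal{X}:=\{(\int f\,d\nu_1,\ldots,\int f\,d\nu_n):\nu\in\mathcal{M}\}\subset\mathbb{R}^n$, let $G:\mathcal{X}\to\mathbb{R}$ be any map, and set $J(\nu):=G(\int f\,d\nu_1,\ldots,\int f\,d\nu_n)$ for $\nu\in\mathcal{M}$. Then $\mathcal{C}$ is finite and, if $x\in\mathcal{X}$ maximizes (respectively, minimizes) $G$ over $\mathcal{X}$, then $x$ may be written as a convex combination $$x=\sum_{\nu\in\mathcal{C}}\rho_\nu\Big(\int f\,d\nu_1,\ldots,\int f\,d\nu_n\Big),\qquad \rho_\nu\ge 0,\ \sum_{\nu\in\mathcal{C}}\rho_\nu=1,$$ and, for any such representation, $\sum_{\nu\in\mathcal{C}}\rho_\nu\nu$ belongs to $\mathcal{M}$ and maximizes (respectively, minimizes) $J$ over $\mathcal{M}$.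
   Context: $\mathcal{B}_A$ denotes the Borel $\sigma$-field of $A$. $X_1,X_2$ are the canonical projections of $I^2$ onto the first and second coordinate. Convex order: probability measures $\lambda_1,\lambda_2$ on $\mathcal{B}_I$ of finite mean are in convex order if $\int\psi\,d\lambda_1\le\int\psi\,d\lambda_2$ for all convex $\psi:I\to\mathbb{R}$. A martingale transport (or coupling) of $\lambda_1$ to $\lambda_2$ is a probability measure $\nu$ on $\mathcal{B}_{I^2}$ with first marginal $\lambda_1$, second marginal $\lambda_2$ and $E_\nu[X_2\mid X_1]=X_1$ $\nu$-a.s. A curtain martingale transport of $\lambda_1$ to $\lambda_2$ is a martingale transport $\nu$ of $\lambda_1$ to $\lambda_2$ for which there exists $\Gamma\in\mathcal{B}_{I^2}$ that carries $\nu$ (i.e. $\nu(\Gamma)=1$) and such that one cannot have $\{(x,y),(x,y_1),(x,y_2),(x',y'),(x',y_1'),(x',y_2')\}\subset\Gamma$ with $x\ne x'$, $y_1<y'<y_2$ and $y_1'<y<y_2'$. *)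

(* Defs.v *)
From HB Require Import structures.
From mathcomp Require Import all_boot all_order all_algebra.
From mathcomp Require Import all_classical all_reals all_analysis.

Set Implicit Arguments.
Unset Strict Implicit.
Unset Printing Implicit Defensive.

Import Order.TTheory GRing.Theory Num.Theory numFieldNormedType.Exports.

Local Open Scope classical_set_scope.
Local Open Scope ring_scope.

(* Conventions.  The interval I is a set of reals.  A probability measure on
   the Borel sigma-field of I (resp. of I ^ 2) is encoded as a Borel probability
   on R (resp. R * R) giving mass 1 to I (resp. I `*` I), a function on I as a
   function on R whose values off I are irrelevant. *)

Section optimization.
Context {R : realType} {T : Type}.
Implicit Types (A : set T) (g : T -> R).

Definition maximizes g A x := A x /\ forall y, A y -> g y <= g x.

Definition minimizes g A x := A x /\ forall y, A y -> g x <= g y.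

End optimization.

(* Meaningful for finite C only: [\sum_(c \in C)] is 0 on infinite supports. *)
Definition convex_combination {R : realType} {T : choiceType} {V : lmodType R}
    (C : set T) (v : T -> V) (rho : T -> R) (x : V) :=
  [/\ forall c, C c -> 0 <= rho c,
      \sum_(c \in C) rho c = 1 &
      x = \sum_(c \in C) rho c *: v c].

Section real_line.
Context {R : realType}.
Implicit Types (I : set R) (f : R -> R).

Definition convex_on I f := @convex_function R R^o I f.

Definition concave_on I f := convex_on I (fun x => - f x).

Definition finite_mean I (l : probability R R) :=
  l.-integrable I (EFin \o (@id R)).

(* Both integrals are well defined in ]-oo, +oo] for l1, l2 of finite mean. *)
Definition convex_order I (l1 l2 : probability R R) :=
  forall psi : R -> R, convex_on I psi ->
    (\int[l1]_(x in I) (psi x)%:E <= \int[l2]_(x in I) (psi x)%:E)%E.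

(* The topological support, relative to I. *)
Definition support_in I (l : probability R R) : set R :=
  [set x | I x /\ forall U : set R, open U -> U x -> (0 < l U)%E].

End real_line.

(* Z is a version of the conditional expectation E_P[X | Y]. *)
Definition is_cond_expectation {d d'} {T : measurableType d}
    {T' : measurableType d'} {R : realType} (P : probability T R)
    (X : T -> R) (Y : T -> T') (Z : T -> R) :=
  [/\ P.-integrable setT (EFin \o X),
      P.-integrable setT (EFin \o Z),
      measurable_fun setT (Z : g_sigma_algebra_preimageType Y -> R) &
      forall A, g_sigma_algebra_preimage Y A ->
        (\int[P]_(w in A) (Z w)%:E = \int[P]_(w in A) (X w)%:E)%E].

Section conditional_law.
Context {R : realType} (nu : probability (R * R)%type R) (a : R).

(* nu (X_2 \in . | X_1 = a); the zero measure if X_1 = a has probability 0. *)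
Definition cond_law (B : set R) : \bar R :=
  ((fine (nu (fst @^-1` [set a])))^-1%:E
    * nu (fst @^-1` [set a] `&` snd @^-1` B))%E.

Let mX1 : measurable (fst @^-1` [set a] : set (R * R)).
Proof.
by rewrite -[X in measurable X]setTI; exact: (measurable_fst measurableT).
Qed.

Let mX2 (B : set R) : measurable B -> measurable (snd @^-1` B : set (R * R)).
Proof.
by move=> mB; rewrite -[X in measurable X]setTI;
  exact: (measurable_snd measurableT).
Qed.

Let cond_law0 : cond_law set0 = 0%E.
Proof. by rewrite /cond_law preimage_set0 setI0 measure0 mule0. Qed.

Let cond_law_ge0 B : (0 <= cond_law B)%E.
Proof. by rewrite mule_ge0// lee_fin invr_ge0 fine_ge0. Qed.

Let cond_law_sigma_additive : semi_sigma_additive cond_law.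
Proof.
move=> F mF tF mUF; rewrite /cond_law preimage_bigcup setI_bigcupr.
rewrite [X in X @ _ --> _](_ : _ = (fun n =>
   ((fine (nu (fst @^-1` [set a])))^-1%:E *
   \sum_(0 <= i < n) nu (fst @^-1` [set a] `&` snd @^-1` F i))%E)); last first.
  by apply/funext => n; rewrite ge0_sume_distrr.
apply: cvgeZl => //; apply: measure_semi_sigma_additive.
- by move=> n; apply: measurableI => //; exact: mX2.
- apply: trivIset_setIl; apply/trivIsetP => i j _ _ ij.
  by move/trivIsetP : tF => /(_ i j I I ij) Fij;
    rewrite -preimage_setI Fij preimage_set0.
- by apply: bigcup_measurable => n _; apply: measurableI => //; exact: mX2.
Qed.

HB.instance Definition _ := isMeasure.Build _ _ _ cond_law
  cond_law0 cond_law_ge0 cond_law_sigma_additive.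

End conditional_law.

Section transports.
Context {R : realType}.
Implicit Type I : set R.

(* A [probability] is a function on all sets, unconstrained on non-measurable
   ones.  Requiring the value 0 there selects exactly one representative of each
   measure on the sigma-field, so that equality of representatives is equality
   of measures; without it no nonempty set of measures closed under equality on
   measurable sets would be finite. *)
Definition zero_off_measurable {d} {T : measurableType d}
    (mu : probability T R) := forall A, ~ measurable A -> mu A = 0%E.

Definition martingale_transport I (l1 l2 : probability R R) :
    set (probability (R * R)%type R) :=
  [set nu | [/\ zero_off_measurable nu,
    nu (I `*` I) = 1%E,
    forall B, measurable B -> nu (fst @^-1` B) = l1 B,
    forall B, measurable B -> nu (snd @^-1` B) = l2 B &
    is_cond_expectation nu snd fst fst]].

Definition curtain_carrier (G : set (R * R)) :=
  forall x y y1 y2 x' y' y1' y2' : R,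
    [set (x, y); (x, y1); (x, y2); (x', y'); (x', y1'); (x', y2')] `<=` G ->
    ~ [/\ x != x', y1 < y' < y2 & y1' < y < y2'].

Definition curtain_transport I (l1 l2 : probability R R) :
    set (probability (R * R)%type R) :=
  [set nu | martingale_transport I l1 l2 nu /\
    exists G : set (R * R), [/\ measurable G, G `<=` I `*` I,
      nu G = 1%E & curtain_carrier G]].

Definition cond_means I (f : R -> R) n (a : 'I_n -> R)
    (nu : probability (R * R)%type R) : 'rV[R]_n :=
  \row_i \int[cond_law nu (a i)]_(y in I) f y.

End transports.

(* Main.v *)
Require Import Defs.
From HB Require Import structures.
From mathcomp Require Import all_boot all_order all_algebra.
From mathcomp Require Import all_classical all_reals all_analysis.
From mathcomp Require Import measurable_realfun ring lra.

Set Implicit Arguments.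
Unset Strict Implicit.
Unset Printing Implicit Defensive.

Import Order.TTheory GRing.Theory Num.Theory numFieldNormedType.Exports.

Local Open Scope classical_set_scope.
Local Open Scope ring_scope.

(* A martingale transport amounts to densities g_i with respect to l2 that sum
   to 1 almost everywhere and have mass p_i = l1 {a_i} and barycentre a_i.

   Say that j lies inside i if some point of {g_j > 0} is strictly between two
   points of {g_i > 0}.  For a curtain transport this is a strict partial order,
   and g_i is determined by what the smaller atoms leave over, since the
   difference of two candidates changes sign at most once and has zero mass and
   mean.  Hence there are finitely many curtain transports.

   By separation in R^n, it remains to maximize sum_i u_i int f g_i, for all
   weights u.  Serve the atoms by decreasing u_i, giving each of them a stretch
   of what is left of l2, found by the intermediate value theorem.  This is a
   curtain transport.  Replacing a convex phi by its chord on each stretch yields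
   a convex psi >= phi, equal to phi where mass is left and affine on the
   stretches.  By Jensen's inequality, psi shows both that the remaining atoms
   can still be served and that the first k atoms jointly minimize int phi,
   for all k.  Abel summation gives the optimality.  The argument is
   carried out for maxima of finitely many affine functions, for which chords
   exist even over unbounded stretches, and passes to -f by monotone
   approximation. *)

(** * Convex functions and hulls on the line *)

(** Two obstacles shape the proof. Densities are determined only almost everywhere, whereas hulls
    and the curtain condition are pointwise; versions with values in [0, 1] everywhere, positive
    only on the slices of a carrier, reconcile the two. And the order of the atoms varies from one
    curtain transport to another; only transports with the same number of atoms inside each i are
    compared, and there are finitely many such counts.

    Separation makes linear functionals sufficient: a vector that no weight vector pushes strictly
    beyond all curtain transports lies in their convex hull, so weights of any sign must be treated.
    That the greedy service never gets stuck is deduced from a transport given beforehand, whose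
    densities [g0] enter through Jensen's inequality. Finally, as the masses p_i are fixed, the
    vector of the int f dnu_i is affine in nu: a mixture of curtain transports representing x is a
    transport with vector x, on which J takes the value G x. *)

Section avoids_hull.
Context {R : realType}.
Implicit Types (S T : set R).

(** Both inequalities are strict, as in [curtain_carrier]: T may touch the ends of the hull of S, so
    that an atom of the second marginal located there can be shared. *)
Definition avoids_hull S T :=
  forall y1 z y2, S y1 -> S y2 -> T z -> ~ (y1 < z < y2).

(** One pair s < t with s in S and t in T fixes the order of all pairs. For t' < s' in the wrong
    order, either s < t' < s' puts t' strictly inside S, or t' < s < t puts s strictly inside T, and
    t' = s contradicts disjointness. Hence [sup S] separates. *)
Lemma avoids_hull_separated S T : (forall y, S y -> ~ T y) ->
  avoids_hull S T -> avoids_hull T S -> S !=set0 -> T !=set0 ->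
  exists t, (forall y, S y -> y <= t) /\ (forall y, T y -> t <= y) \/
            (forall y, T y -> y <= t) /\ (forall y, S y -> t <= y).
Proof.
wlog: S T / exists s t, [/\ S s, T t & s < t].
  move=> wl dST ST TS [s Ss] [t Tt]; have [st|st|st] := ltgtP s t.
  - apply: (wl S T _ dST ST TS); first by exists s, t.
      by exists s.
    by exists t.
  - have dTS y : T y -> ~ S y by move=> Ty Sy; exact: dST Ty.
    have TS' : exists t s, [/\ T t, S s & t < s] by exists t, s.
    have [u [h|h]] := wl T S TS' dTS TS ST (ex_intro _ _ Tt) (ex_intro _ _ Ss).
      by exists u; right.
    by exists u; left.
  - by move: Tt; rewrite -st => /(dST _ Ss).
move=> [s [t [Ss Tt st]]] dST ST TS _ _.
have le_ST s' t' : S s' -> T t' -> s' <= t'.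
  move=> Ss' Tt'; rewrite leNgt; apply/negP => t's'.
  have [t's|st'|t's] := ltgtP t' s.
  - by apply: (TS t' s t) => //; rewrite t's.
  - by apply: (ST s t' s') => //; rewrite st'.
  - by move: Tt'; rewrite t's; exact: dST.
exists (sup S); left; split => y.
  by move=> Sy; apply: ub_le_sup => //; exists t => z Sz; exact: le_ST.
by move=> Ty; apply: ge_sup => [|z Sz]; [exists s|exact: le_ST].
Qed.

End avoids_hull.

Section piecewise_linear.
Context {R : realType}.

(** The slopes of these functions are bounded on the whole line, which gives chords over unbounded
    sets, and the functions are integrable as soon as the identity is. *)
Inductive pwl : (R -> R) -> Prop :=
| pwl_affine s t : pwl (fun y => s * y + t)
| pwl_max phi s t : pwl phi -> pwl (fun y => Num.max (phi y) (s * y + t)).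

Lemma pwl_support phi x : pwl phi ->
  exists s, forall y, phi x + s * (y - x) <= phi y.
Proof.
elim=> [s t|{}phi s t _ [s' ih]].
  by exists s => y; lra.
have [le1|lt1] := leP (s * x + t) (phi x).
  by exists s' => y; rewrite le_max ih.
by exists s => y; rewrite le_max; apply/orP; right; lra.
Qed.

Lemma pwl_min_slope phi : pwl phi ->
  exists s, forall x y, x <= y -> phi x + s * (y - x) <= phi y.
Proof.
elim=> [s t|{}phi s t _ [s' ih]].
  by exists s => x y xy; lra.
exists (Num.min s s') => x y xy; rewrite addr_maxl ge_max.
apply/andP; split; rewrite le_max; apply/orP; [left|right].
  apply: le_trans (ih _ _ xy); rewrite lerD2l ler_wpM2r ?subr_ge0//.
  by rewrite ge_min lexx orbT.
have : Num.min s s' * (y - x) <= s * (y - x).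
  by rewrite ler_wpM2r ?subr_ge0// ge_min lexx.
by move=> h; lra.
Qed.

Lemma pwl_max_slope phi : pwl phi ->
  exists s, forall x y, x <= y -> phi y <= phi x + s * (y - x).
Proof.
elim=> [s t|{}phi s t _ [s' ih]].
  by exists s => x y xy; lra.
exists (Num.max s s') => x y xy; rewrite ge_max addr_maxl !le_max.
apply/andP; split; apply/orP; [left|right].
  apply: le_trans (ih _ _ xy) _; rewrite lerD2l ler_wpM2r ?subr_ge0//.
  by rewrite le_max lexx orbT.
have : s * (y - x) <= Num.max s s' * (y - x).
  by rewrite ler_wpM2r ?subr_ge0// le_max lexx.
by move=> h; lra.
Qed.

Lemma pwl_chord_itv phi c d : pwl phi -> c < d ->
  exists s t, (forall y, c <= y <= d -> phi y <= s * y + t) /\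
              (forall y, y <= c \/ d <= y -> s * y + t <= phi y).
Proof.
move=> pphi cd; have dc0 : 0 < d - c by rewrite subr_gt0.
pose s := (phi d - phi c) / (d - c).
have sE : s * (d - c) = phi d - phi c by rewrite /s divfK// gt_eqF.
exists s, (phi c - s * c); split => y.
  move=> /andP[cy yd]; have [r sr] := pwl_support y pphi.
  rewrite -(ler_pM2r dc0).
  have := sr c; have := sr d => h1 h2; nra.
move=> [yc|dy].
  have [r sr] := pwl_support c pphi.
  have := sr y; have := sr d => h1 h2.
  have rs : r <= s by rewrite -(ler_pM2r dc0); lra.
  nra.
have [r sr] := pwl_support d pphi.
have := sr y; have := sr c => h1 h2.
have rs : s <= r by rewrite -(ler_pM2r dc0); lra.
nra.
Qed.

(** For bounded S take the secant through [inf S] and [sup S], or a support line if S is a single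
    point. For S unbounded to the right take the line through the graph at [inf S] whose slope is an
    upper bound of all slopes, and symmetrically to the left. S cannot be unbounded on both sides,
    since it would then straddle the point z of T. *)
Lemma pwl_chord phi S T : pwl phi -> S !=set0 -> T !=set0 ->
  avoids_hull S T ->
  exists s t, (forall y, S y -> phi y <= s * y + t) /\
              (forall y, T y -> s * y + t <= phi y).
Proof.
move=> pphi [x Sx] [z Tz] ST.
have S0 : S !=set0 by exists x.
have Sinf (c := inf S) : has_lbound S ->
    (forall y, S y -> c <= y) /\ forall y, c < y -> exists2 y', S y' & y' < y.
  move=> lS; split=> [y Sy|y cy]; first exact: ge_inf.
  by have [y' Sy' y'y] := inf_lt S0 cy; exists y'.
have Ssup (d := sup S) : has_ubound S ->
    (forall y, S y -> y <= d) /\ forall y, y < d -> exists2 y', S y' & y < y'.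
  move=> uS; split=> [y Sy|y cy]; first exact: ub_le_sup.
  by have [y' Sy' y'y] := sup_gt S0 cy; exists y'.
have lNS : ~ has_lbound S -> forall y, exists2 y', S y' & y' < y.
  move=> nl y; apply: contrapT => nS; apply: nl; exists y => y' Sy'.
  by rewrite leNgt; apply/negP => y'y; apply: nS; exists y'.
have uNS : ~ has_ubound S -> forall y, exists2 y', S y' & y < y'.
  move=> nl y; apply: contrapT => nS; apply: nl; exists y => y' Sy'.
  by rewrite leNgt; apply/negP => y'y; apply: nS; exists y'.
have [lS|/lNS{}lNS] := pselect (has_lbound S);
  have [uS|/uNS{}uNS] := pselect (has_ubound S).
- have [Sc cS] := Sinf lS; have [Sd dS] := Ssup uS.
  have [cd|dc] := ltP (inf S) (sup S).
    have [s [t [h1 h2]]] := pwl_chord_itv pphi cd.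
    exists s, t; split=> [y Sy|y Ty]; first by rewrite h1// Sc//= Sd.
    apply: h2; have [yc|yc] := leP y (inf S); first by left.
    right; rewrite leNgt; apply/negP => yd.
    have [y1 Sy1 y1y] := cS _ yc; have [y2 Sy2 yy2] := dS _ yd.
    by apply: (ST _ _ _ Sy1 Sy2 Ty); rewrite y1y.
  have Sx1 y : S y -> y = x.
    move=> Sy; apply/eqP; rewrite eq_le; apply/andP; split.
      exact: le_trans (Sd _ Sy) (le_trans dc (Sc _ Sx)).
    exact: le_trans (Sd _ Sx) (le_trans dc (Sc _ Sy)).
  have [s sP] := pwl_support x pphi.
  exists s, (phi x - s * x); split=> [y /Sx1 ->|y _]; first by lra.
  by apply: le_trans (sP y); lra.
- have [Sc cS] := Sinf lS.
  have [s sP] := pwl_max_slope pphi.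
  exists s, (phi (inf S) - s * inf S); split=> y.
    by move=> /Sc /sP; lra.
  move=> Ty; have yc : y <= inf S.
    rewrite leNgt; apply/negP => /cS[y1 Sy1 y1y]; have [y2 Sy2 yy2] := uNS y.
    by apply: (ST _ _ _ Sy1 Sy2 Ty); rewrite y1y.
  by have := sP _ _ yc; lra.
- have [Sd dS] := Ssup uS.
  have [s sP] := pwl_min_slope pphi.
  exists s, (phi (sup S) - s * sup S); split=> y.
    by move=> /Sd /sP; lra.
  move=> Ty; have yc : sup S <= y.
    rewrite leNgt; apply/negP => /dS[y2 Sy2 yy2]; have [y1 Sy1 y1y] := lNS y.
    by apply: (ST _ _ _ Sy1 Sy2 Ty); rewrite y1y.
  by have := sP _ _ yc; lra.
- have [y1 Sy1 y1z] := lNS z; have [y2 Sy2 zy2] := uNS z.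
  by exfalso; apply: (ST _ _ _ Sy1 Sy2 Tz); rewrite y1z.
Qed.

End piecewise_linear.

Section convex_support.
Context {R : realType}.
Implicit Types (I : set R) (psi : R -> R).

Lemma convex_onP I psi : convex_on I psi <-> forall x y t, I x -> I y ->
  0 <= t <= 1 -> psi (t * x + (1 - t) * y) <= t * psi x + (1 - t) * psi y.
Proof.
split=> [psic x y t Ix Iy t01|psic t x y /set_mem Ix /set_mem Iy].
  have [t0 t1] := andP t01.
  have := psic (Itv01 t0 t1) x y (mem_set Ix) (mem_set Iy).
  by rewrite !convRE.
by rewrite !convRE; apply: psic => //; rewrite ge0 le1.
Qed.

Lemma open_itv_around I x : open I -> I x -> exists y z, [/\ I y, I z, y < x & x < z].
Proof.
move=> oI /oI /nbhs_ballP[e /= e0 eI]; exists (x - e / 2), (x + e / 2); split.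
- apply: eI; rewrite /ball/= opprB addrC subrK gtr0_norm ?divr_gt0//.
  by rewrite ltr_pdivrMr// ltr_pMr// ltr1n.
- apply: eI; rewrite /ball/= opprD addNKr normrN gtr0_norm ?divr_gt0//.
  by rewrite ltr_pdivrMr// ltr_pMr// ltr1n.
- by rewrite ltrBlDr ltrDl divr_gt0.
- by rewrite ltrDl divr_gt0.
Qed.

(** Secant slopes to the left of x are at most those to the right, so the supremum of the former is
    a subgradient. It is finite because I, being open, has points on both sides of x. *)
Lemma convex_support I psi x : open I -> convex_on I psi -> I x ->
  exists s, forall y, I y -> psi x + s * (y - x) <= psi y.
Proof.
move=> oI /convex_onP psic Ix.
pose sl z := (psi x - psi z) / (x - z).
have slE z : z != x -> sl z * (x - z) = psi x - psi z.
  by move=> zx; rewrite /sl divfK// subr_eq0 eq_sym.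
have le_sl z y : I z -> I y -> z < x -> x < y -> sl z <= sl y.
  move=> Iz Iy zx xy.
  have yz0 : 0 < y - z by rewrite subr_gt0 (lt_trans zx).
  pose t := (y - x) / (y - z).
  have tE : t * (y - z) = y - x by rewrite /t divfK// gt_eqF.
  have t01 : 0 <= t <= 1.
    apply/andP; split; first by apply: divr_ge0; lra.
    by rewrite ler_pdivrMr// mul1r lerD2l lerN2 ltW.
  have := psic z y t Iz Iy t01.
  have -> : t * z + (1 - t) * y = x.
    by move: tE; lra.
  move=> h.
  have h1 : psi x * (y - z) <= (y - x) * psi z + (x - z) * psi y.
    have -> : x - z = (1 - t) * (y - z) by move: tE; lra.
    rewrite -tE; nra.
  have zx' : z != x by rewrite lt_eqF.
  have yx' : y != x by rewrite gt_eqF.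
  have e1 := slE _ zx'; have e2 := slE _ yx'.
  have p1 : 0 < x - z by rewrite subr_gt0.
  have p2 : 0 < y - x by rewrite subr_gt0.
  rewrite -(ler_pM2r p1) e1 -(ler_pM2r p2); nra.
have [z0 [y0 [Iz0 Iy0 z0x xy0]]] := open_itv_around oI Ix.
pose A := [set sl z | z in [set z | I z /\ z < x]].
have A0 : A !=set0 by exists (sl z0), z0.
exists (sup A) => y Iy; have [yx|xy|->] := ltgtP y x.
- have yx' : y != x by rewrite lt_eqF.
  have : sl y <= sup A.
    apply: ub_le_sup; last by exists y.
    by exists (sl y0) => _ [z [Iz zx] <-]; exact: le_sl.
  have p1 : 0 < x - y by rewrite subr_gt0.
  by rewrite -(ler_pM2r p1) slE//; lra.
- have yx' : y != x by rewrite gt_eqF.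
  have : sup A <= sl y.
    by apply: ge_sup => // _ [z [Iz zx] <-]; exact: le_sl.
  have p1 : 0 < y - x by rewrite subr_gt0.
  have := slE _ yx'.
  rewrite -(ler_pM2r p1); lra.
- by rewrite subrr mulr0 addr0.
Qed.

End convex_support.

(** * Densities with respect to a probability *)

Section integral_toolkit.
Context d (T : measurableType d) (R : realType) (mu : {measure set T -> \bar R}).
Implicit Types f g : T -> R.

Local Notation L1 f := (mu.-integrable setT (EFin \o f)).

Lemma L1_measurable f : L1 f -> measurable_fun setT f.
Proof. by move=> /measurable_int/measurable_EFinP. Qed.

Lemma L1D f g : L1 f -> L1 g -> L1 (fun x => f x + g x).
Proof. by move=> f1 g1; apply: (integrableD measurableT f1 g1). Qed.

Lemma L1B f g : L1 f -> L1 g -> L1 (fun x => f x - g x).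
Proof. by move=> f1 g1; apply: (integrableB measurableT f1 g1). Qed.

Lemma L1Z k f : L1 f -> L1 (fun x => k * f x).
Proof. by move=> f1; apply: (integrableZl measurableT k f1). Qed.

Lemma L1N f : L1 f -> L1 (fun x => - f x).
Proof.
by move=> /(L1Z (-1)); apply: eq_integrable => // x _ /=; rewrite mulN1r.
Qed.

Lemma L1_sum (J : Type) (s : seq J) (P : pred J) (F : J -> T -> R) :
  (forall i, P i -> L1 (F i)) -> L1 (fun x => \sum_(i <- s | P i) F i x).
Proof.
move=> F1; have := @integrable_sum _ _ _ mu _ measurableT _ s P _ F1.
by apply: eq_integrable => // x _ /=; rewrite sumEFin.
Qed.

Lemma L1_dominated f g : measurable_fun setT f -> L1 g ->
  (forall x, `|f x| <= g x) -> L1 f.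
Proof.
move=> mf g1 fg; apply: le_integrable g1 => //; first exact/measurable_EFinP.
by move=> x _ /=; rewrite lee_fin (le_trans (fg x))// ler_norm.
Qed.

Lemma L1_norm f : L1 f -> L1 (fun x => `|f x|).
Proof. exact: integrable_norm. Qed.

Lemma L1M f g : L1 f -> measurable_fun setT g -> (forall x, 0 <= g x <= 1) ->
  L1 (fun x => f x * g x).
Proof.
move=> f1 mg g01; apply: L1_dominated (L1_norm f1) _.
  by apply: measurable_funM => //; exact: L1_measurable.
move=> x; have /andP[g0 g1] := g01 x.
by rewrite normrM (ger0_norm g0) ler_piMr.
Qed.

Lemma Rintegral_sum (J : Type) (s : seq J) (P : pred J) (F : J -> T -> R) :
  (forall i, P i -> L1 (F i)) ->
  \int[mu]_x (\sum_(i <- s | P i) F i x) = \sum_(i <- s | P i) \int[mu]_x F i x.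
Proof.
move=> F1; elim: s => [|i s ih].
  by under eq_Rintegral do rewrite big_nil; rewrite big_nil Rintegral_cst// mul0r.
under eq_Rintegral do rewrite big_cons; rewrite big_cons; case: ifP => // Pi.
by rewrite RintegralD// ?ih//; [exact: F1|exact: L1_sum].
Qed.

Lemma Rintegral_ae f g : measurable_fun setT f -> measurable_fun setT g ->
  {ae mu, forall x, f x = g x} -> \int[mu]_x f x = \int[mu]_x g x.
Proof.
move=> mf mg fg; congr fine; apply: ae_eq_integral => //; try exact/measurable_EFinP.
by apply: filterS fg => x fg _; rewrite fg.
Qed.

Lemma Rintegral_ge0_eq0 f : L1 f -> {ae mu, forall x, 0 <= f x} ->
  \int[mu]_x f x = 0 -> {ae mu, forall x, f x = 0}.
Proof.
move=> f1 f0 If; have mf := L1_measurable f1.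
have mnf : measurable_fun setT (fun x => `|f x|) by exact: measurableT_comp.
have I0 : \int[mu]_x `|f x| = 0.
  rewrite -If; apply: Rintegral_ae => //.
  by apply: filterS f0 => x; exact: ger0_norm.
have := @ae_eq_integral_abs _ _ _ mu _ measurableT (EFin \o f).
move=> /(_ ltac:(exact/measurable_EFinP))[+ _].
have : (\int[mu]_x `|(f x)%:E| = 0)%E.
  have fin : (\int[mu]_x `|f x|%:E \is a fin_num)%E.
    by apply: integrable_fin_num => //; exact: L1_norm.
  by rewrite -[LHS](fineK fin) [X in X%:E]I0.
by move=> e /(_ e); apply: filterS => x /(_ I)[].
Qed.

Lemma Rintegral_cvg (f_ : nat -> T -> R) f g :
  (forall n, measurable_fun setT (f_ n)) -> measurable_fun setT f ->
  L1 g -> (forall n x, `|f_ n x| <= g x) ->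
  (forall x, f_ ^~ x @ \oo --> f x) ->
  (fun n => \int[mu]_x f_ n x) @ \oo --> \int[mu]_x f x.
Proof.
move=> mf_ mf g1 fg f_f.
have [f1 _ cvg] := @dominated_convergence _ _ _ mu setT measurableT
  (fun n => EFin \o f_ n) (EFin \o f) (EFin \o g)
  ltac:(by move=> n; exact/measurable_EFinP) ltac:(exact/measurable_EFinP)
  ltac:(by apply: aeW => x _; apply: cvg_EFin;
    [exact: nearW|exact: f_f])
  g1
  ltac:(by apply: aeW => x n _; rewrite lee_fin fg).
have fin : (\int[mu]_x (f x)%:E \is a fin_num)%E by exact: integrable_fin_num.
move: cvg; rewrite /comp/= -[X in _ --> X](fineK fin).
by move=> /fine_cvgP[].
Qed.

End integral_toolkit.

Lemma cvg_sumr (T : Type) (R : realType) (F : set_system T) {FF : Filter F}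
    (J : Type) (s : seq J) (f : J -> T -> R) (c : J -> R) :
  (forall i, f i x @[x --> F] --> c i) ->
  \sum_(i <- s) f i x @[x --> F] --> \sum_(i <- s) c i.
Proof.
move=> fc; elim: s => [|i s ih].
  by under eq_fun do rewrite big_nil; rewrite big_nil; exact: cvg_cst.
under eq_fun do rewrite big_cons; rewrite big_cons.
by apply: cvgD; [exact: fc|exact: ih].
Qed.

Section density_uniqueness.
Context {R : realType} (l : probability R R).
Implicit Types g h r : R -> R.

Definition positive_set g := [set y | 0 < g y].

(** The bounds hold everywhere and not only almost everywhere: products with integrable functions
    are then integrable, and pointwise hull conditions can be used. *)
Definition density g := measurable_fun setT g /\ forall y, 0 <= g y <= 1.

Hypothesis l_mean : l.-integrable setT (EFin \o (@id R)).

Lemma L1_cst k : l.-integrable setT (EFin \o cst k).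
Proof. exact: finite_measure_integrable_cst. Qed.

Lemma L1_density g : density g -> l.-integrable setT (EFin \o g).
Proof.
move=> [mg g01]; have := L1M (L1_cst 1) mg g01.
by apply: eq_integrable => // x _ /=; rewrite mul1r.
Qed.

Lemma L1_id_density g : density g -> l.-integrable setT (EFin \o (fun y => y * g y)).
Proof. by move=> [mg g01]; exact: L1M. Qed.

(* The sets {g > h} and {h > g} are on either side of some t, so that
   (y - t) (h - g) has constant sign and zero integral. *)
Lemma density_unique g h r r' :
  density g -> density h -> (forall y, 0 <= r y) -> (forall y, 0 <= r' y) ->
  {ae l, forall y, g y + r y = h y + r' y} ->
  avoids_hull (positive_set g) (positive_set r) ->
  avoids_hull (positive_set h) (positive_set r') ->
  \int[l]_y g y = \int[l]_y h y ->
  \int[l]_y (y * g y) = \int[l]_y (y * h y) ->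
  {ae l, forall y, g y = h y}.
Proof.
move=> dg dh r0 r'0 ghr gr hr' Egh Eygh.
(* The identity g + r = h + r' holds only almost everywhere. At the points where it does, h < g
   forces r' > 0 and g < h forces r > 0, which brings in the hull conditions. *)
pose Good y := g y + r y = h y + r' y.
pose P := [set y | Good y /\ h y < g y]; pose N := [set y | Good y /\ g y < h y].
have PN y : P y -> ~ N y by move=> [_ hg] [_ gh]; have := lt_trans hg gh; rewrite ltxx.
have g0 y : 0 <= g y by have /andP[] := dg.2 y.
have h0 y : 0 <= h y by have /andP[] := dh.2 y.
have Pg y : P y -> 0 < g y by move=> [_]; apply: le_lt_trans.
have Nh y : N y -> 0 < h y by move=> [_]; apply: le_lt_trans.
have Pr' y : P y -> 0 < r' y by move=> [gd hg]; have := r0 y; rewrite /Good in gd; lra.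
have Nr y : N y -> 0 < r y by move=> [gd hg]; have := r'0 y; rewrite /Good in gd; lra.
have aPN : avoids_hull P N.
  by move=> y1 z y2 /Pg P1 /Pg P2 /Nr Nz; exact: gr.
have aNP : avoids_hull N P.
  by move=> y1 z y2 /Nh P1 /Nh P2 /Pr' Nz; exact: hr'.
have g1 := L1_density dg; have h1 := L1_density dh.
have yg1 := L1_id_density dg; have yh1 := L1_id_density dh.
have Ehg c : \int[l]_y (c * (h y - g y)) = 0.
  by rewrite RintegralZl ?RintegralB ?Egh ?subrr ?mulr0//; exact: L1B.
have one_sign c : c != 0 -> {ae l, forall y, 0 <= c * (h y - g y)} ->
    {ae l, forall y, g y = h y}.
  move=> c0 c_ge0; have := Rintegral_ge0_eq0 (L1Z c (L1B h1 g1)) c_ge0 (Ehg c).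
  apply: filterS => y /eqP; rewrite mulf_eq0 (negbTE c0)/= subr_eq0.
  by move=> /eqP.
have [[p Pp]|/set0P/negP/negPn/eqP P0] := pselect (P !=set0); last first.
  apply: (one_sign 1) => //; apply: filterS ghr => y gd.
  rewrite mul1r subr_ge0 leNgt; apply/negP => hg.
  by have : P y by []; rewrite P0.
have [[n Nn]|/set0P/negP/negPn/eqP N0] := pselect (N !=set0); last first.
  apply: (one_sign (-1)); first by rewrite oppr_eq0.
  apply: filterS ghr => y gd.
  rewrite mulN1r opprB subr_ge0 leNgt; apply/negP => hg.
  by have : N y by []; rewrite N0.
have [t tP] := avoids_hull_separated PN aPN aNP (ex_intro _ _ Pp) (ex_intro _ _ Nn).
suff [c c0 cP] : exists2 c, c != 0 & {ae l, forall y, 0 <= c * ((y - t) * (h y - g y))}.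
  pose k y := c * (y * h y - y * g y) - c * (t * (h y - g y)).
  have kE y : c * ((y - t) * (h y - g y)) = k y by rewrite /k; ring.
  have k1 : l.-integrable setT (EFin \o k).
    by apply: L1B; apply: L1Z; [exact: L1B|apply: L1Z; exact: L1B].
  have Ik : \int[l]_y k y = 0.
    have hg1 := L1B h1 g1; have yhg1 := L1B yh1 yg1.
    rewrite RintegralB//; [|exact: L1Z|by do 2 apply: L1Z].
    rewrite RintegralZl// RintegralB// Eygh subrr mulr0 sub0r.
    by rewrite RintegralZl ?Ehg ?mulr0 ?oppr0//; exact: L1Z.
  have k0 : {ae l, forall y, k y = 0}.
    by apply: (Rintegral_ge0_eq0 k1 _ Ik); apply: filterS cP => y; rewrite kE.
  have hgt : {ae l, forall y, y != t -> h y - g y = 0}.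
    apply: filterS k0 => y; rewrite -kE => /eqP.
    rewrite !mulf_eq0 (negbTE c0)/= subr_eq0.
    by case: eqVneq => //= _ /eqP.
  (* At y = t the factor y - t vanishes and gives no information. As h - g is almost everywhere zero
     elsewhere, equality of the masses reads [(h t - g t) * l [set t] = 0]. *)
  have mt : measurable [set t] by exact: measurable_set1.
  have := Ehg 1; under eq_Rintegral do rewrite mul1r.
  rewrite (@Rintegral_ae _ _ _ l _ (fun y => (h t - g t) * \1_[set t] y)); first last.
  - apply: filterS hgt => y; rewrite indicE; have [->|yt] := eqVneq y t.
      by rewrite mem_set ?mulr1.
    by rewrite memNset ?mulr0 => [->//|/eqP]; rewrite (negbTE yt).
  - by apply: measurable_funM => //; exact: measurable_indic.
  - by apply: measurable_funB; [case: dh|case: dg].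
  rewrite RintegralZl//; last exact: integrable_indic.
  rewrite /Rintegral integral_indic// setIT => /eqP; rewrite mulf_eq0 => /orP[hg|lt0].
    apply: filterS hgt => y; have [->|_ /(_ isT)/eqP] := eqVneq y t.
      by move=> _; move: hg; rewrite subr_eq0 => /eqP.
    by rewrite subr_eq0 => /eqP.
  have nt : {ae l, forall y, y != t}.
    exists [set t]; split => //.
      by apply/eqP; rewrite -fine_eq0// fin_num_measure.
    by move=> y/= /negP/negPn/eqP.
  apply: filterS2 hgt nt => y /[apply] /eqP.
  by rewrite subr_eq0 => /eqP.
have [[Pt tN]|[Nt tP']] := tP.
  exists 1 => //; apply: filterS ghr => y gd; rewrite mul1r.
  have [yt|ty|->] := ltgtP y t; last by rewrite subrr mul0r.
    rewrite nmulr_rge0 ?subr_lt0// subr_le0 leNgt; apply/negP => gh.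
    by have := tN y (conj gd gh); rewrite leNgt yt.
  rewrite pmulr_rge0 ?subr_gt0// subr_ge0 leNgt; apply/negP => gh.
  by have := Pt y (conj gd gh); rewrite leNgt ty.
exists (-1); first by rewrite oppr_eq0.
apply: filterS ghr => y gd; rewrite mulN1r -mulrN opprB.
have [yt|ty|->] := ltgtP y t; last by rewrite subrr mul0r.
  rewrite nmulr_rge0 ?subr_lt0// subr_le0 leNgt; apply/negP => gh.
  by have := tP' y (conj gd gh); rewrite leNgt yt.
rewrite pmulr_rge0 ?subr_gt0// subr_ge0 leNgt; apply/negP => gh.
by have := Nt y (conj gd gh); rewrite leNgt ty.
Qed.

End density_uniqueness.

(** * Leftmost parts of a density, and the stretch serving one atom *)

Section initial_parts.
Context {R : realType} (l : probability R R).
Hypothesis l_mean : l.-integrable setT (EFin \o (@id R)).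
Implicit Types w g G : R -> R.

Lemma Rintegral_eventually (f_ : nat -> R -> R) f g :
  (forall n, measurable_fun setT (f_ n)) -> measurable_fun setT f ->
  l.-integrable setT (EFin \o g) -> (forall n x, `|f_ n x| <= g x) ->
  (forall x, exists N, forall n, (N <= n)%N -> f_ n x = f x) ->
  forall e, 0 < e -> exists n, `|\int[l]_x f_ n x - \int[l]_x f x| < e.
Proof.
move=> mf_ mf g1 fg ev e e0.
have := @Rintegral_cvg _ _ _ l f_ f g mf_ mf g1 fg.
have f_f x : f_ ^~ x @ \oo --> f x.
  by have [N NP] := ev x; apply: cvg_near_cst; exists N => // n /= /NP ->.
move=> /(_ f_f)/cvgrPdist_lt/(_ _ e0)[N _ /(_ N (leqnn N))] h.
by exists N; rewrite distrC.
Qed.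

Lemma max0_integrable f : l.-integrable setT (EFin \o f) ->
  l.-integrable setT (EFin \o (fun y => Num.max (f y) 0)).
Proof.
move=> f1; apply: L1_dominated (L1_norm f1) _.
  by apply: measurable_maxr => //; exact: L1_measurable f1.
by move=> x; have [f0|f0] := leP (f x) 0; rewrite ?normr0.
Qed.

Lemma natSinv_lt (e : R) : 0 < e ->
  exists N, forall n, (N <= n)%N -> n.+1%:R^-1 < e.
Proof.
by move=> e0; have [N _ h] := near_infty_natSinv_lt (PosNum e0); exists N.
Qed.

Lemma nat_gt (x : R) : exists N, forall n, (N <= n)%N -> x < n%:R.
Proof.
have [N _ h] := nbhs_infty_gtr x; exists N => n Nn; exact: h.
Qed.

(** The leftmost part of w, of some mass: G follows w up to a cut point and vanishes beyond it. The
    cut point is left unnamed, and G may take any fraction of w there, so that an atom of l can be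
    split. *)
Definition initial_part w G := [/\ density G, forall y, G y <= w y &
  forall y z, y < z -> G y = w y \/ G z = 0].

(** The cut q is the s-quantile of w. By one-sided continuity, the mass [L q] strictly to the left
    of q is at most s and the mass [H q] including q is at least s; interpolation between the two
    adjusts the fraction of w kept at q. *)
Lemma initial_part_ex w s : density w -> 0 <= s <= \int[l]_y w y ->
  exists G, initial_part w G /\ \int[l]_y G y = s.
Proof.
move=> dw /andP[]; rewrite le_eqVlt => /predU1P[<- _|s0].
  exists (cst 0); split; last by rewrite Rintegral_cst// mul0r.
  split=> [|y|y z _]; [|by case: dw => _ /(_ y)/andP[]|by right].
  by split=> // y; rewrite lexx/=.
rewrite le_eqVlt => /predU1P[->|sm].
  exists w; split => //; split=> // y z _; by left.
have [mw w01] := dw.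
have w0 y : 0 <= w y by have /andP[] := w01 y.
have w1 y : w y <= 1 by have /andP[] := w01 y.
pose f (B : set R) y := w y * \1_B y.
have f01 B y : 0 <= f B y <= 1.
  by rewrite /f indicE; case: (_ \in _); rewrite ?mulr1 ?mulr0 ?w0//= lexx/=.
have mB B : measurable B -> measurable_fun setT (f B).
  by move=> mB; apply: measurable_funM => //; exact: measurable_indic.
have B1 B : measurable B -> l.-integrable setT (EFin \o f B).
  by move=> ?; apply: L1_density; split; [exact: mB|exact: f01].
have evB (B_ : nat -> set R) B : (forall n, measurable (B_ n)) -> measurable B ->
    (forall y, exists N, forall n, (N <= n)%N -> B_ n y <-> B y) ->
    forall e, 0 < e -> exists n, `|\int[l]_x f (B_ n) x - \int[l]_x f B x| < e.
  move=> mB_ mB' ev; apply: (@Rintegral_eventually _ _ (cst 1)).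
  - by move=> n; exact: mB.
  - exact: mB.
  - exact: L1_cst.
  - by move=> n x; rewrite ger0_norm; have /andP[] := f01 (B_ n) x.
  - move=> y; have [N NP] := ev y; exists N => n /NP nP.
    by rewrite /f; congr (_ * _); rewrite !indicE; congr (_%:R); congr nat_of_bool;
      apply/idP/idP; rewrite !inE => /nP.
pose L x := \int[l]_y f [set y | y < x] y.
pose H x := \int[l]_y f [set y | y <= x] y.
have mlt x : measurable [set y : R | y < x].
  by rewrite -set_itvNyo; exact: measurable_itv.
have mle x : measurable [set y : R | y <= x].
  by rewrite -set_itvNyc; exact: measurable_itv.
have L_le x x' : x <= x' -> L x <= L x'.
  move=> xx'; apply: le_Rintegral => //; try exact: B1.
  move=> y _; rewrite /f ler_wpM2l// !indicE.
  rewrite ler_nat; case: (boolP (y \in [set y | y < x])) => //.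
  by rewrite inE/= => yx; rewrite mem_set//=; exact: lt_le_trans xx'.
pose A := [set x | L x <= s].
have A0 : A !=set0.
  have [||n] := evB (fun n => [set y | y < - n%:R]) set0 _ measurable0 _ s s0.
  - by move=> n; exact: mlt.
  - move=> y; have [N NP] := nat_gt (- y); exists N => n /NP h; split=> //=.
    by rewrite ltNge -ltNge => h'; lra.
  rewrite [X in `|_ - X|](_ : _ = 0); last first.
    rewrite -[RHS](@Rintegral_set0 _ _ _ l (fun=> 0)).
    under eq_Rintegral do rewrite /f indic0 mulr0.
    by rewrite Rintegral_set0 Rintegral_cst// mul0r.
  rewrite subr0 => h; exists (- n%:R); rewrite /A/=.
  exact/ltW/(le_lt_trans _ h)/ler_norm.
have uA : has_ubound A.
  have [|||n] := evB (fun n => [set y | y < n%:R]) setT _ measurableT _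
    (\int[l]_y w y - s).
  - by move=> n; exact: mlt.
  - by move=> y; have [N NP] := nat_gt y; exists N => n /NP h; split.
  - by rewrite subr_gt0.
  rewrite [X in `|_ - X|](_ : _ = \int[l]_y w y); last first.
    by apply: eq_Rintegral => y _; rewrite /f indicT mulr1.
  rewrite -/(L n%:R) ltr_norml => /andP[h _]; exists n%:R => x Lx.
  rewrite leNgt; apply/negP => nx.
  have := L_le _ _ (ltW nx); have : L x <= s by [].
  lra.
pose q := sup A.
have Lq : L q <= s.
  rewrite leNgt; apply/negP => sL.
  have [|||n] := evB (fun n => [set y | y < q - n.+1%:R^-1]) [set y | y < q] _
    (mlt q) _ (L q - s).
  - by move=> n; exact: mlt.
  - move=> y; have [qy|yq] := leP q y.
      exists 0%N => n _ /=; split; last by rewrite ltNge qy.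
      by move=> h; apply: lt_le_trans h _; rewrite gerBl invr_ge0.
    have [N NP] := @natSinv_lt (q - y) ltac:(by rewrite subr_gt0).
    exists N => n /NP /=; move: (n.+1%:R^-1) => u h; split=> // _.
    by rewrite ltrBrDr addrC -ltrBrDr.
  - by rewrite subr_gt0.
  rewrite -/(L q) -/(L (q - n.+1%:R^-1)) ltr_norml => /andP[h _].
  have [|x Ax xq] := @sup_gt _ A (q - n.+1%:R^-1) A0.
    by rewrite gtrBl invr_gt0.
  have := L_le _ _ (ltW xq); have : L x <= s by [].
  lra.
have Hq : s <= H q.
  rewrite leNgt; apply/negP => sH.
  have [|||n] := evB (fun n => [set y | y < q + n.+1%:R^-1]) [set y | y <= q] _
    (mle q) _ (s - H q).
  - by move=> n; exact: mlt.
  - move=> y; have [yq|qy] := leP y q.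
      exists 0%N => n _ /=; split=> // _.
      by apply: le_lt_trans yq _; rewrite ltrDl invr_gt0.
    have [N NP] := @natSinv_lt (y - q) ltac:(by rewrite subr_gt0).
    exists N => n /NP /=; move: (n.+1%:R^-1) => u h.
    split=> [h'|]; last by rewrite leNgt qy.
    by exfalso; move: h; rewrite ltrBrDr addrC => /(lt_trans h'); rewrite ltxx.
  - by rewrite subr_gt0.
  rewrite -/(H q) -/(L (q + n.+1%:R^-1)) ltr_norml => /andP[_ h].
  have : q + n.+1%:R^-1 <= q.
    by apply: ub_le_sup => //; rewrite /A/=; lra.
  by rewrite gerDl leNgt invr_gt0 ltr0Sn.
(* The fraction of w kept at q. If q carries no mass, division by zero makes it 0, and then L q = s
   = H q. *)
pose th := (s - L q) / (H q - L q).
have thE : th * (H q - L q) = s - L q.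
  rewrite /th; have [HL|HL] := eqVneq (H q - L q) 0; last by rewrite divfK.
  by rewrite HL mulr0; lra.
have th01 : 0 <= th <= 1.
  rewrite /th; have [HL|HL] := eqVneq (H q - L q) 0.
    by rewrite HL invr0 mulr0 lexx ler01.
  have HL0 : 0 < H q - L q by rewrite lt_neqAle eq_sym HL/=; lra.
  apply/andP; split; first by apply: divr_ge0; lra.
  by rewrite ler_pdivrMr// mul1r; lra.
pose G y := (1 - th) * f [set y | y < q] y + th * f [set y | y <= q] y.
have Glt y : y < q -> G y = w y.
  by move=> yq; rewrite /G /f !indicE !mem_set/= ?(ltW yq)//; ring.
have Ggt y : q < y -> G y = 0.
  move=> qy; rewrite /G /f !indicE !memNset/= ?mulr0 ?addr0//.
  - by rewrite leNgt qy.
  - by apply/negP; rewrite -leNgt ltW.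
have [th0 th1] := andP th01.
have Gq : G q = th * w q.
  rewrite /G /f !indicE (@mem_set _ [set y | y <= q])/= ?lexx//.
  by rewrite memNset/= ?ltxx//; ring.
have G0w y : 0 <= G y <= w y.
  have [/Glt->|/Ggt->|->] := ltgtP y q; rewrite ?lexx ?w0//.
  by rewrite Gq mulr_ge0//= ler_piMl.
exists G; split; last first.
  rewrite RintegralD//; [|apply: L1Z; exact: B1|apply: L1Z; exact: B1].
  rewrite RintegralZl//; last exact: B1.
  rewrite RintegralZl//; last exact: B1.
  by rewrite -/(L q) -/(H q); move: thE; lra.
split.
- split=> [|y].
    by apply: measurable_funD; apply: measurable_funM => //; exact: mB.
  by have /andP[-> /= h] := G0w y; exact: le_trans h (w1 y).
- by move=> y; have /andP[] := G0w y.
- move=> y z yz; have [yq|qy] := ltP y q; first by left; exact: Glt.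
  by right; apply: Ggt; exact: le_lt_trans yz.
Qed.

(** If G' y < G y at a single y, then G' vanishes to the right of y and G equals w to its left, so
    G' <= G everywhere, against the order of the masses. *)
Lemma initial_part_le w G G' : initial_part w G -> initial_part w G' ->
  \int[l]_y G y < \int[l]_y G' y -> forall y, G y <= G' y.
Proof.
move=> [dG Gw iG] [dG' Gw' iG'] GG' y; rewrite leNgt; apply/negP => G'y.
have G0 z : 0 <= G z by have [_ /(_ z)/andP[]] := dG.
have G'0 z : 0 <= G' z by have [_ /(_ z)/andP[]] := dG'.
move: GG'; apply/negP; rewrite -leNgt.
apply: le_Rintegral => //; [exact: L1_density..|move=> z _].
rewrite leNgt; apply/negP => Gz.
have [yz|zy|yz] := ltgtP y z.
- have [e|e] := iG' _ _ yz; first by move: G'y; rewrite e ltNge Gw.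
  by move: Gz; rewrite e ltNge G0.
- have [e|e] := iG _ _ zy; first by move: Gz; rewrite e ltNge Gw'.
  by move: G'y; rewrite e ltNge G'0.
- by move: G'y; rewrite yz ltNge (ltW Gz).
Qed.

(** Strict bounds on the mass make {G > 0} nonempty and bounded above; K is its supremum. It serves
    as the strike of the put and call bounds in [shadow_ex]. *)
Lemma initial_part_cut w G : density w -> initial_part w G ->
  0 < \int[l]_y G y < \int[l]_y w y ->
  exists K, (forall y, y < K -> G y = w y) /\ (forall y, K < y -> G y = 0).
Proof.
move=> dw [dG Gw iG] /andP[G0 Gm].
have Gge0 z : 0 <= G z by have [_ /(_ z)/andP[]] := dG.
have P0 : positive_set G !=set0.
  apply: contrapT => /set0P/negP/negPn/eqP P0; move: G0.
  rewrite (_ : \int[l]_y G y = 0) ?ltxx//.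
  rewrite -[RHS](mul0r (fine (l setT))) -Rintegral_cst//.
  apply: eq_Rintegral => y _; apply/eqP; rewrite eq_le Gge0 andbT leNgt.
  by apply/negP => Gy; have : positive_set G y by []; rewrite P0.
have [z Gz] : exists z, G z < w z.
  apply: contrapT => nz; move: Gm; apply/negP; rewrite -leNgt.
  apply: le_Rintegral => //; [exact: L1_density..|move=> z _].
  by rewrite leNgt; apply/negP => Gz; apply: nz; exists z.
have uP : has_ubound (positive_set G).
  exists z => y Gy; rewrite leNgt; apply/negP => zy.
  have [e|e] := iG _ _ zy; first by move: Gz; rewrite e ltxx.
  by move: Gy; rewrite /positive_set/= e ltxx.
exists (sup (positive_set G)); split=> y.
  move=> /(sup_gt P0)[y' Gy' yy']; have [//|e] := iG _ _ yy'.
  by move: Gy'; rewrite /positive_set/= e ltxx.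
move=> Ky; apply/eqP; rewrite eq_le Gge0 andbT leNgt; apply/negP => Gy.
by have := ub_le_sup uP Gy; rewrite leNgt Ky.
Qed.

(* The density is G (s + p) - G s, where G s is the leftmost part of w of mass
   s. *)
Lemma shadow_ex w p a : density w -> 0 < p <= \int[l]_y w y ->
  (p = \int[l]_y w y -> \int[l]_y (y * w y) = p * a) ->
  (forall K, p * (K - a) <= \int[l]_y (Num.max (K - y) 0 * w y)) ->
  (forall K, p * (a - K) <= \int[l]_y (Num.max (y - K) 0 * w y)) ->
  exists g, [/\ density g, forall y, g y <= w y, \int[l]_y g y = p,
    \int[l]_y (y * g y) = p * a &
    avoids_hull (positive_set g) (positive_set (fun y => w y - g y))].
Proof.
move=> dw /andP[p0]; set m := \int[l]_y w y.
rewrite le_eqVlt => /predU1P[pm /(_ pm) wa _ _|pm _ put call].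
  exists w; split=> // y1 z y2 _ _; rewrite /positive_set/= subrr ltxx//.
have mE : \int[l]_y w y = m by [].
clearbody m; have m0 : 0 <= m by exact: ltW (lt_trans p0 pm).
(* Clamping the mass to [0, m] defines the leftmost part for every real s, so that B below is
   continuous on the whole line. *)
pose clamp s : R := Num.min m (Num.max 0 s).
have clamp01 s : 0 <= clamp s <= m.
  by rewrite /clamp le_min m0 le_max lexx ge_min lexx.
have clampE s : 0 <= s -> s <= m -> clamp s = s.
  by move=> s0 sm; rewrite /clamp (max_r s0) (min_r sm).
have clamp_le s t : s <= t -> clamp s <= clamp t.
  move=> st; rewrite /clamp le_min !ge_min lexx/= ge_max !le_max lexx st.
  by rewrite !orbT.
have clamp_lip s t : s <= t -> clamp t - clamp s <= t - s.
  move=> st; rewrite /clamp; apply: (@le_trans _ _ (Num.max 0 t - Num.max 0 s)).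
    have : Num.max 0 s <= Num.max 0 t by rewrite ge_max !le_max lexx st !orbT.
    move: (Num.max 0 s) (Num.max 0 t) => u v uv.
    by case: (leP m u) => ?; case: (leP m v) => ?; lra.
  by case: (leP 0 s) => ?; case: (leP 0 t) => ?; lra.
pose Q s := [set G | initial_part w G /\ \int[l]_y G y = clamp s].
pose G s := xget (cst 0) (Q s).
have GP s : initial_part w (G s) /\ \int[l]_y G s y = clamp s.
  have clampw : 0 <= clamp s <= \int[l]_y w y by rewrite mE.
  have [G' G'P] := initial_part_ex dw clampw.
  exact: (@xgetPex _ (cst 0) (Q s) (ex_intro _ G' G'P)).
have dG s : density (G s) by have [[]] := GP s.
have Gw s y : G s y <= w y by have [[]] := GP s.
have G0 s y : 0 <= G s y by have [_ /(_ y)/andP[]] := dG s.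
(* [G s] depends on s only through [clamp s]: equal masses give the same function, and different
   ones are ordered by [initial_part_le]. *)
have G_le s t y : s <= t -> G s y <= G t y.
  move=> /clamp_le; rewrite le_eqVlt => /predU1P[e|e].
    by rewrite /G /Q e.
  by apply: (initial_part_le (GP s).1 (GP t).1); rewrite (GP s).2 (GP t).2.
clearbody G; clear Q; clearbody clamp.
pose B s := \int[l]_y (y * G s y).
have id_G s := L1_id_density l_mean (dG s).
have abs1 : l.-integrable setT (EFin \o (fun y : R => `|y|)) by exact: L1_norm.
(* B need not be Lipschitz, as y is unbounded. Truncating [|y|] at n leaves a tail of integral at
   most e; n + 1 instead of n keeps N positive. *)
have modB e : 0 < e -> exists N, 0 < N /\
    forall s t, s <= t -> `|B t - B s| <= N * (t - s) + e.
  move=> e0.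
  have tail1 n : l.-integrable setT (EFin \o (fun y => Num.max (`|y| - n%:R) 0)).
    by apply: max0_integrable; apply: L1B => //; exact: L1_cst.
  have [||||n] := @Rintegral_eventually
      (fun n y => Num.max (`|y| - n%:R) 0) (cst 0) (fun y => `|y|) _ _ abs1 _ _ e e0.
  - by move=> n; exact: L1_measurable.
  - by [].
  - move=> n x; have [h|h] := leP (`|x| - n%:R) 0; first by rewrite normr0.
    by rewrite gtr0_norm// gerBl.
  - move=> x; have [N NP] := nat_gt `|x|; exists N => n /NP h.
    by apply: max_r; lra.
  rewrite [X in _ - X](_ : _ = 0) ?subr0; last by rewrite Rintegral_cst// mul0r.
  move=> /ltW/(le_trans (ler_norm _)) he.
  exists n.+1%:R; split=> // s t st.
  have dGG : density (fun y => G t y - G s y).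
    split; first by apply: measurable_funB; [case: (dG t)|case: (dG s)].
    move=> y; rewrite subr_ge0 G_le//=; have := G0 s y.
    by have [_ /(_ y)/andP[_]] := dG t; lra.
  have yGG : l.-integrable setT (EFin \o (fun y => y * (G t y - G s y))).
    exact: L1_id_density.
  have -> : B t - B s = \int[l]_y (y * (G t y - G s y)).
    by rewrite -RintegralB//; apply: eq_Rintegral => y _; ring.
  apply: (le_trans (le_normr_Rintegral _ _)) => //.
  have GG1 := L1_density l dGG.
  apply: (@le_trans _ _ (\int[l]_y (n.+1%:R * (G t y - G s y) +
      Num.max (`|y| - n%:R) 0))).
    apply: le_Rintegral => //; first exact: L1_norm.
      by apply: L1D => //; exact: L1Z.
    move=> y _; have [_ /(_ y)/andP[]] := dGG => /= h0 h1.
    rewrite normrM (ger0_norm h0).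
    have : `|y| <= n.+1%:R + Num.max (`|y| - n%:R) 0.
      have : `|y| - n%:R <= Num.max (`|y| - n%:R) 0 by rewrite le_max lexx.
      by rewrite -natr1; lra.
    have : 0 <= Num.max (`|y| - n%:R) 0 by rewrite le_max lexx orbT.
    move: (n.+1%:R) (Num.max _ _) h0 h1 => N M h0 h1 M0 yM.
    apply: (@le_trans _ _ ((N + M) * (G t y - G s y))); first exact: ler_wpM2r.
    by rewrite mulrDl lerD2l ler_piMr.
  rewrite RintegralD//; last exact: L1Z.
  rewrite RintegralZl// RintegralB//; try exact: L1_density.
  rewrite (GP s).2 (GP t).2 lerD// ler_wpM2l//.
  exact: clamp_lip.
have B_cont : continuous B.
  move=> s; apply/cvgrPdist_lt => e e0.
  have [N [N0 NP]] := modB (e / 2) ltac:(by rewrite divr_gt0).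
  near=> t.
  have h : `|s - t| < e / 2 / N.
    by near: t; apply: cvgr_dist_lt => //; rewrite !divr_gt0.
  have h' : N * `|s - t| < e / 2 by rewrite mulrC -ltr_pdivlMr.
  have [st|ts] := leP s t.
    rewrite distrC; apply: (le_lt_trans (NP _ _ st)).
    by move: h'; rewrite ler0_norm ?subr_le0//; lra.
  apply: (le_lt_trans (NP _ _ (ltW ts))).
  by move: h'; rewrite gtr0_norm ?subr_gt0//; lra.
pose A s := B (s + p) - B s.
have mw0 : 0 <= m - p by rewrite subr_ge0 ltW.
have A_cont : {within `[0, m - p], continuous A}.
  apply: continuous_subspaceT => s; apply: cvgB; last exact: B_cont.
  apply: (@continuous_comp _ _ _ (fun s => s + p) B); last exact: B_cont.
  by apply: cvgD; [exact: cvg_id|exact: cvg_cst].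
have w1 := L1_density l dw; have yw1 := L1_id_density l_mean dw.
have B0 : B 0 = 0.
  have := @Rintegral_ge0_eq0 _ _ _ l (G 0) (L1_density l (dG 0))
    (aeW _ (G0 0)) ltac:(by rewrite (GP 0).2 clampE).
  move=> G00; rewrite /B (@Rintegral_ae _ _ _ l _ (cst 0)).
  - by rewrite Rintegral_cst// mul0r.
  - exact: L1_measurable.
  - by [].
  - by apply: filterS G00 => y ->; rewrite mulr0.
have Bm : B m = \int[l]_y (y * w y).
  have wG0 y : 0 <= w y - G m y by rewrite subr_ge0.
  have IwG : \int[l]_y (w y - G m y) = 0.
    by rewrite RintegralB ?(GP m).2 ?mE ?clampE ?subrr//; exact: L1_density.
  have h := Rintegral_ge0_eq0 (L1B w1 (L1_density l (dG m))) (aeW _ wG0) IwG.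
  apply: Rintegral_ae; [exact: L1_measurable (id_G m)|exact: L1_measurable yw1|].
  by apply: filterS h => y /eqP; rewrite subr_eq0 => /eqP ->.
(* At the cut K of the leftmost part of mass p, the put integral is [K * p - B p], so [put] says
   that this part has mean at most a. *)
have A0 : A 0 <= p * a.
  rewrite /A add0r B0 subr0.
  have [iG IG] := GP p; rewrite clampE// in IG; try exact: ltW.
  have [|K [Kl Kr]] := initial_part_cut dw iG; first by rewrite IG mE p0.
  have := put K; rewrite [X in _ <= X](_ : _ = K * p - B p).
    by rewrite mulrBr (mulrC p K) lerD2l lerN2.
  have -> : K * p = \int[l]_y (K * G p y).
    by rewrite RintegralZl ?IG//; exact: L1_density.
  rewrite -RintegralB//; last by apply: L1Z; exact: L1_density.
  apply: eq_Rintegral => y _; have [yK|Ky|->] := ltgtP y K.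
  - by rewrite Kl// max_l ?subr_ge0 ?ltW//; ring.
  - by rewrite Kr// max_r ?subr_le0 ?ltW//; ring.
  - by rewrite subrr maxxx; ring.
(* Symmetrically, [call] at the cut of [G (m - p)] says that the rightmost part of mass p has mean
   at least a. *)
have Amp : p * a <= A (m - p).
  rewrite /A subrK Bm.
  have [iG IG] := GP (m - p); rewrite (clampE _ mw0) in IG; last by rewrite gerBl ltW.
  have [|K [Kl Kr]] := initial_part_cut dw iG; first by rewrite IG mE subr_gt0 pm gtrBl.
  have wG1 : l.-integrable setT (EFin \o (fun y => w y - G (m - p) y)).
    by apply: L1B => //; exact: L1_density.
  have IwG : K * p = \int[l]_y (K * (w y - G (m - p) y)).
    rewrite RintegralZl// RintegralB ?IG ?mE; [congr (_ * _); ring|..];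
      by try exact: L1_density.
  have := call K.
  rewrite [X in _ <= X](_ : _ = \int[l]_y (y * w y) - B (m - p) - K * p).
    by rewrite mulrBr (mulrC p K) lerD2r.
  rewrite IwG -RintegralB// -RintegralB//; [|exact: L1B|exact: L1Z].
  apply: eq_Rintegral => y _; have [yK|Ky|->] := ltgtP y K.
  - by rewrite Kl// max_r ?subr_le0 ?ltW//; ring.
  - by rewrite Kr// max_l ?subr_ge0 ?ltW//; ring.
  - by rewrite subrr maxxx; ring.
have AE s : A s = B (s + p) - B s by [].
clearbody A; have [|s] := IVT mw0 A_cont (v := p * a).
  by apply/andP; split; [rewrite ge_min A0|rewrite le_max Amp orbT].
rewrite in_itv/= => /andP[s0 smp] As.
have spm : s + p <= m by rewrite -lerBrDr.
have Is : \int[l]_y G s y = s.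
  by rewrite (GP s).2 clampE//; apply: le_trans spm; rewrite lerDl ltW.
have Isp : \int[l]_y G (s + p) y = s + p.
  by rewrite (GP _).2 clampE// addr_ge0// ltW.
have Gss y : G s y <= G (s + p) y by apply: G_le; rewrite lerDl ltW.
exists (fun y => G (s + p) y - G s y); split.
- split; first by apply: measurable_funB; [case: (dG (s + p))|case: (dG s)].
  move=> y; rewrite subr_ge0 Gss/=.
  have [_ /(_ y)/andP[_]] := dG (s + p); have := G0 s y; lra.
- by move=> y; have := Gw (s + p) y; have := G0 s y; lra.
- by rewrite RintegralB ?Is ?Isp; [rewrite addrC addKr|..] => //; exact: L1_density.
- by rewrite -As AE /B -RintegralB//; apply: eq_Rintegral => y _; ring.
- move=> y1 z y2; rewrite /positive_set/= => g1 g2 gz /andP[y1z zy2].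
  (* Strictly between two points of the stretch, [G (s + p)] equals w and [G s] is 0, so nothing of
     w is left at z. *)
  have [[_ _ iGp] _] := GP (s + p); have [[_ _ iG] _] := GP s.
  have [e|e] := iGp _ _ zy2; last by have := G0 s y2; lra.
  have [e'|e'] := iG _ _ y1z; first by have := Gw (s + p) y1; lra.
  by lra.
Unshelve. all: by end_near.
Qed.

End initial_parts.

(** * Greedy construction of curtain densities *)

Section coupling_densities.
Context {R : realType} (l : probability R R).
Hypothesis l_mean : l.-integrable setT (EFin \o (@id R)).
Context (n : nat) (p a : 'I_n -> R).
Implicit Types (g : 'I_n -> R -> R) (h phi : R -> R) (T : {set 'I_n}).

(* [g i] is the density with respect to l of the part of the second marginal
   that is transported from the atom [a i], of mass [p i]. *)
Definition coupling_density g :=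
  [/\ forall i, density (g i), {ae l, forall y, \sum_i g i y = 1},
      forall i, \int[l]_y g i y = p i &
      forall i, \int[l]_y (y * g i y) = p i * a i].

(** The curtain condition on fibres: of two distinct atoms, at most one lies inside the other. *)
Definition curtain_density g := forall i j, i != j ->
  avoids_hull (positive_set (g i)) (positive_set (g j)) \/
  avoids_hull (positive_set (g j)) (positive_set (g i)).

Lemma pwl_integrable phi : pwl phi -> l.-integrable setT (EFin \o phi).
Proof.
elim=> [s t|{}phi s t _ ih].
  by apply: L1D; [exact: L1Z|exact: L1_cst].
have st : l.-integrable setT (EFin \o (fun y => s * y + t)).
  by apply: L1D; [exact: L1Z|exact: L1_cst].
apply: L1_dominated (L1D (L1_norm ih) (L1_norm st)) _.
  by apply: measurable_maxr; [exact: L1_measurable ih|exact: L1_measurable st].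
move=> y; have [_|_] := leP (phi y) (s * y + t).
  by rewrite lerDr normr_ge0.
by rewrite lerDl normr_ge0.
Qed.

Lemma pwl_density_integrable phi h : pwl phi -> density h ->
  l.-integrable setT (EFin \o (fun y => phi y * h y)).
Proof. by move=> pphi [mh h01]; apply: L1M => //; exact: pwl_integrable. Qed.

Lemma Rintegral_affine_density s t h m b : density h -> \int[l]_y h y = m ->
  \int[l]_y (y * h y) = m * b -> \int[l]_y ((s * y + t) * h y) = m * (s * b + t).
Proof.
move=> dh hm hb; have h1 := L1_density l dh; have yh1 := L1_id_density l_mean dh.
under eq_Rintegral do rewrite mulrDl -mulrA.
rewrite RintegralD; [|by []|exact: L1Z|exact: L1Z].
by rewrite !RintegralZl// hm hb; ring.
Qed.

Lemma pwl_jensen phi h m b : pwl phi -> density h -> \int[l]_y h y = m ->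
  \int[l]_y (y * h y) = m * b -> m * phi b <= \int[l]_y (phi y * h y).
Proof.
move=> pphi dh hm hb; have [s sP] := pwl_support b pphi.
have := Rintegral_affine_density s (phi b - s * b) dh hm hb.
rewrite (_ : s * b + _ = phi b) => [<-|]; last by ring.
apply: le_Rintegral => //.
- by apply: pwl_density_integrable => //; exact: pwl_affine.
- exact: pwl_density_integrable.
move=> y _; have [_ /(_ y)/andP[h0 _]] := dh.
by apply: ler_wpM2r => //; apply: le_trans (sP y); lra.
Qed.

Lemma coupling_density_sum g phi : coupling_density g ->
  l.-integrable setT (EFin \o phi) ->
  \sum_i \int[l]_y (phi y * g i y) = \int[l]_y phi y.
Proof.
move=> [dg g1 _ _] phi1.
have phig i : l.-integrable setT (EFin \o (fun y => phi y * g i y)).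
  by have [mg g01] := dg i; exact: L1M.
rewrite -Rintegral_sum//; apply: Rintegral_ae.
- by apply: L1_measurable; exact: L1_sum.
- exact: L1_measurable phi1.
- by apply: filterS g1 => y gy; rewrite -mulr_sumr gy mulr1.
Qed.

Lemma coupling_density_sum_le g phi T : coupling_density g ->
  l.-integrable setT (EFin \o phi) -> (forall y, 0 <= phi y) ->
  \sum_(i in T) \int[l]_y (phi y * g i y) <= \int[l]_y phi y.
Proof.
move=> cg phi1 phi0; rewrite -(coupling_density_sum cg phi1).
rewrite [leRHS](bigID (mem T))/= lerDl sumr_ge0// => i _.
apply: Rintegral_ge0 => y _; rewrite mulr_ge0//.
by have [/(_ i)[_ /(_ y)/andP[]]] := cg.
Qed.

Section greedy.
Hypothesis p_gt0 : forall i, 0 < p i.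
Variables (u : 'I_n -> R) (g0 : 'I_n -> R -> R).
Hypothesis cg0 : coupling_density g0.

Let rest T g y := 1 - \sum_(i in T) g i y.

(* The function psi replaces phi on the hulls of the [g i], i in T, by convex
   functions that are affine on each hull; it certifies optimality. *)
Let certificate T g phi psi := [/\ pwl psi, forall y, phi y <= psi y,
  forall y, 0 < rest T g y -> psi y = phi y &
  forall i, i \in T -> \int[l]_y (psi y * g i y) <= p i * psi (a i)].

(** Abel summation in inductive form. The threshold c stands for the weight of an atom still to be
    served; lowering it from [u i] to c adds [u i - c] times the joint advantage of all atoms served
    up to i. *)
Let dominates T g (c : R) := forall phi g', pwl phi -> coupling_density g' ->
  0 <= \sum_(i in T) (u i - c) *
    (\int[l]_y (phi y * g' i y) - \int[l]_y (phi y * g i y)).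

(** Invariant of the greedy construction once the atoms of T are served. Certificates are required
    only while something is left over, because extending them uses [pwl_chord], which needs a point
    of the rest; when nothing is left, T contains all atoms. *)
Record partial_curtain T g := {
  pc_density : forall i, i \in T -> density (g i);
  pc_mass : forall i, i \in T -> \int[l]_y g i y = p i;
  pc_mean : forall i, i \in T -> \int[l]_y (y * g i y) = p i * a i;
  pc_rest : forall y, 0 <= rest T g y;
  pc_avoids_rest : forall i, i \in T ->
    avoids_hull (positive_set (g i)) (positive_set (rest T g));
  pc_avoids : forall i j, i \in T -> j \in T -> i != j ->
    avoids_hull (positive_set (g i)) (positive_set (g j)) \/
    avoids_hull (positive_set (g j)) (positive_set (g i));
  pc_certificate : positive_set (rest T g) !=set0 -> forall phi, pwl phi ->
    exists psi, certificate T g phi psi;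
  pc_dominates : forall c, (forall i, i \in T -> c <= u i) -> dominates T g c }.

Section partial_curtain_theory.
Variables (T : {set 'I_n}) (g : 'I_n -> R -> R).
Hypothesis dg : forall i, i \in T -> density (g i).
Hypothesis mass_g : forall i, i \in T -> \int[l]_y g i y = p i.
Hypothesis mean_g : forall i, i \in T -> \int[l]_y (y * g i y) = p i * a i.
Hypothesis rest_ge0 : forall y, 0 <= rest T g y.

Let r := rest T g.

Lemma density_rest : density r.
Proof.
split=> [|y]; last first.
  rewrite rest_ge0/= gerBl sumr_ge0// => i iT.
  by have [_ /(_ y)/andP[]] := dg iT.
apply: measurable_funB => //; apply: L1_measurable (l) _ _.
by apply: L1_sum => i iT; apply: L1_density; exact: dg.
Qed.

Lemma Rintegral_rest phi : pwl phi -> \int[l]_y (phi y * r y) =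
  \int[l]_y phi y - \sum_(i in T) \int[l]_y (phi y * g i y).
Proof.
move=> pphi; have phi1 := pwl_integrable pphi.
have phig i : i \in T -> l.-integrable setT (EFin \o (fun y => phi y * g i y)).
  by move=> iT; apply: pwl_density_integrable => //; exact: dg.
rewrite -Rintegral_sum// -RintegralB//; last exact: L1_sum.
by apply: eq_Rintegral => y _; rewrite -mulr_sumr /r /rest; ring.
Qed.

Lemma mass_rest : \int[l]_y r y = \sum_(i | i \notin T) p i.
Proof.
have p1 := pwl_affine (0 : R) 1.
have := Rintegral_rest p1; have := coupling_density_sum cg0 (pwl_integrable p1).
have E h : \int[l]_y ((0 * y + 1) * h y) = \int[l]_y h y.
  by apply: eq_Rintegral => y _; rewrite mul0r add0r mul1r.
rewrite E; under eq_bigr do rewrite E.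
move=> <-; under [X in _ - X]eq_bigr => i iT do rewrite E mass_g//.
have [_ _ m0 _] := cg0; under eq_bigr do rewrite m0.
by rewrite [X in X - _](bigID (mem T))/= addrAC subrr add0r => ->.
Qed.

Lemma mean_rest : \int[l]_y (y * r y) = \sum_(i | i \notin T) p i * a i.
Proof.
have p1 := pwl_affine (1 : R) 0.
have := Rintegral_rest p1; have := coupling_density_sum cg0 (pwl_integrable p1).
have E h : \int[l]_y ((1 * y + 0) * h y) = \int[l]_y (y * h y).
  by apply: eq_Rintegral => y _; rewrite mul1r addr0.
rewrite E; under eq_bigr do rewrite E.
move=> <-; under [X in _ - X]eq_bigr => i iT do rewrite E mean_g//.
have [_ _ _ m0] := cg0; under eq_bigr do rewrite m0.
by rewrite [X in X - _](bigID (mem T))/= addrAC subrr add0r => ->.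
Qed.

(** The rest still dominates the unserved atoms in convex order. As psi equals phi on the rest, the
    rest receives the integral of psi minus what the [g i] take. In the coupling [g0], Jensen's
    inequality gives each atom at least [p i * psi (a i)]; for i in T this covers what [g i] takes,
    by the certificate, and for the others it is at least [p i * phi (a i)]. *)
Lemma rest_criterion phi psi : pwl phi -> certificate T g phi psi ->
  \sum_(i | i \notin T) p i * phi (a i) <= \int[l]_y (phi y * r y).
Proof.
move=> pphi [ppsi phi_psi psi_rest psi_g].
rewrite (_ : \int[l]_y (phi y * r y) = \int[l]_y (psi y * r y)); last first.
  apply: eq_Rintegral => y _; have := rest_ge0 y; rewrite le_eqVlt.
  by move=> /predU1P[e|/psi_rest->//]; rewrite /r -e !mulr0.
rewrite (Rintegral_rest ppsi) -(coupling_density_sum cg0 (pwl_integrable ppsi)).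
rewrite [X in _ <= X - _](bigID (mem T))/= addrAC.
have [dg0 _ mass0 mean0] := cg0.
apply: (@le_trans _ _ (\sum_(i | i \notin T) p i * psi (a i))).
  by apply: ler_sum => i _; rewrite ler_pM2l.
apply: (@le_trans _ _ (\sum_(i | i \notin T) \int[l]_y (psi y * g0 i y))).
  by apply: ler_sum => i _; exact: pwl_jensen.
rewrite lerDr subr_ge0; apply: ler_sum => i iT.
by apply: le_trans (psi_g _ iT) _; exact: pwl_jensen.
Qed.

Lemma rest_eq0 : ~ (positive_set r !=set0) -> T = [set: 'I_n]%SET.
Proof.
move=> /set0P/negP/negPn/eqP r0; have := mass_rest.
rewrite (_ : \int[l]_y r y = 0); last first.
  rewrite -[RHS](mul0r (fine (l setT))) -Rintegral_cst//.
  apply: eq_Rintegral => y _; apply/eqP; rewrite eq_le rest_ge0 andbT leNgt.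
  by apply/negP => ry; have : positive_set r y by []; rewrite r0.
move=> /esym/psumr_eq0P h; apply/setP => i; rewrite !inE; apply/negPn/negP => iT.
by have := p_gt0 i; rewrite h ?ltxx// => j _; exact: ltW.
Qed.

(** Write phi = psi - k with k >= 0. Each [g i] has the least possible integral of psi, by the
    certificate and Jensen's inequality. Together they have the largest possible integral of k,
    namely all of it, since k vanishes wherever something is left over. If nothing is left, T is
    everything and both sums equal the integral of phi. *)
Lemma certificate_dominates phi g' : pwl phi -> coupling_density g' ->
  (positive_set r !=set0 -> exists psi, certificate T g phi psi) ->
  0 <= \sum_(i in T) (\int[l]_y (phi y * g' i y) - \int[l]_y (phi y * g i y)).
Proof.
move=> pphi cg' cert; rewrite sumrB subr_ge0.
have [r0|/[dup] r0 /rest_eq0 TE] := pselect (positive_set r !=set0); last first.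
  have := Rintegral_rest pphi.
  rewrite (_ : \int[l]_y (phi y * r y) = 0); last first.
    rewrite -[RHS](mul0r (fine (l setT))) -Rintegral_cst//.
    apply: eq_Rintegral => y _; have [ry|] := ltP 0 (r y).
      by exfalso; apply: r0; exists y.
    by move=> ry; rewrite (_ : r y = 0) ?mulr0//; apply/eqP; rewrite eq_le ry rest_ge0.
  move=> /esym/eqP; rewrite subr_eq0 => /eqP <-.
  rewrite -(coupling_density_sum cg' (pwl_integrable pphi)).
  rewrite le_eqVlt; apply/orP; left; apply/eqP.
  by apply: eq_bigl => i; rewrite TE inE.
have [psi [ppsi phi_psi psi_rest psi_g]] := cert r0.
have psi1 := pwl_integrable ppsi; have phi1 := pwl_integrable pphi.
pose k y := psi y - phi y.
have k1 : l.-integrable setT (EFin \o k) by exact: L1B.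
have k0 y : 0 <= k y by rewrite subr_ge0.
have split_k h : density h -> \int[l]_y (phi y * h y) =
    \int[l]_y (psi y * h y) - \int[l]_y (k y * h y).
  move=> dh; rewrite -RintegralB//.
  - by apply: eq_Rintegral => y _; rewrite /k; ring.
  - exact: pwl_density_integrable.
  - by case: dh => mh h01; exact: L1M.
have [dg' _ mass' mean'] := cg'.
under eq_bigr => i iT do rewrite (split_k _ (dg iT)).
under [leRHS]eq_bigr => i iT do rewrite (split_k _ (dg' i)).
rewrite !sumrB; apply: lerB.
  apply: ler_sum => i iT; apply: le_trans (psi_g _ iT) _.
  exact: pwl_jensen.
apply: le_trans (coupling_density_sum_le T cg' k1 k0) _.
have kg i : i \in T -> l.-integrable setT (EFin \o (fun y => k y * g i y)).
  by move=> iT; have [mg g01] := dg iT; exact: L1M.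
rewrite -Rintegral_sum// le_eqVlt; apply/orP; left; apply/eqP.
apply: eq_Rintegral => y _; rewrite -mulr_sumr.
have := rest_ge0 y; rewrite le_eqVlt => /predU1P[e|/psi_rest e].
  by rewrite (_ : \sum_(i in T) g i y = 1) ?mulr1//; move: e; rewrite /rest; lra.
by rewrite /k e subrr mul0r.
Qed.

End partial_curtain_theory.

(** By [rest_criterion] the rest passes the put and call tests of [shadow_ex] at [a i], which
    supplies a stretch h for the atom i. Being part of the rest, h has no point strictly inside the
    hulls of the earlier stretches. *)
Lemma partial_curtain_step T g i : partial_curtain T g -> i \notin T ->
  (forall j, j \in T -> u i <= u j) ->
  exists g', partial_curtain (i |: T) g'.
Proof.
move=> [dg mass_g mean_g rest0 avoid_rest avoid cert dom] iT ui.
have dr := density_rest dg rest0.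
have mr := mass_rest dg mass_g.
have mer := mean_rest dg mean_g.
have r_neq0 : positive_set (rest T g) !=set0.
  apply: contrapT => /(rest_eq0 dg mass_g rest0) TE.
  by move: iT; rewrite TE inE.
(* Nonnegativity of phi allows the other unserved atoms to be dropped; puts and calls are of this
   kind. *)
have crit phi : pwl phi -> (forall y, 0 <= phi y) ->
    p i * phi (a i) <= \int[l]_y (phi y * rest T g y).
  move=> pphi phi0; have [psi psiP] := cert r_neq0 _ pphi.
  apply: le_trans (rest_criterion dg rest0 pphi psiP).
  rewrite (bigD1 i)//= lerDl sumr_ge0// => j _.
  by rewrite mulr_ge0// ltW.
have pi_rest : 0 < p i <= \int[l]_y rest T g y.
  rewrite p_gt0/= mr (bigD1 i)//= lerDl sumr_ge0// => j _.
  by rewrite ltW.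
have [] := @shadow_ex _ l l_mean _ _ (a i) dr pi_rest.
(* If i takes all the mass left, no other atom is unserved, all masses being positive, and the rest
   has barycentre [a i]. *)
- rewrite mr mer (bigD1 i)//= => /eqP; rewrite -subr_eq0 opprD addNKr oppr_eq0.
  rewrite psumr_eq0; last by move=> j _; exact: ltW.
  move=> /allP h; rewrite (bigD1 i)//= big1 ?addr0// => j jP.
  have := h j (mem_index_enum _); rewrite jP/= => /eqP pj.
  by have := p_gt0 j; rewrite pj ltxx.
- move=> K; have pput : pwl (fun y => Num.max (-1 * y + K) (0 * y + 0)).
    by apply: pwl_max; exact: pwl_affine.
  have E y : Num.max (-1 * y + K) (0 * y + 0) = Num.max (K - y) 0.
    by rewrite mulN1r mul0r addr0 addrC.
  have := crit _ pput; rewrite E; under eq_Rintegral do rewrite E.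
  move=> h; apply: le_trans (h _) => [|y]; last by rewrite E le_max lexx orbT.
  by rewrite ler_pM2l// le_max lexx.
- move=> K; have pput : pwl (fun y => Num.max (1 * y - K) (0 * y + 0)).
    by apply: pwl_max; exact: pwl_affine.
  have E y : Num.max (1 * y - K) (0 * y + 0) = Num.max (y - K) 0.
    by rewrite mul1r mul0r addr0.
  have := crit _ pput; rewrite E; under eq_Rintegral do rewrite E.
  move=> h; apply: le_trans (h _) => [|y]; last by rewrite E le_max lexx orbT.
  by rewrite ler_pM2l// le_max lexx.
move=> h [dh hr mass_h mean_h avoid_h].
pose g' j := if j == i then h else g j.
have g'i : g' i = h by rewrite /g' eqxx.
have g'T j : j \in T -> g' j = g j.
  by move=> jT; rewrite /g'; case: eqP => // ji; move: iT; rewrite -ji jT.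
have rest' y : rest (i |: T) g' y = rest T g y - h y.
  rewrite /rest big_setU1//= g'i (eq_bigr (fun j => g j y)); first by ring.
  by move=> j jT; rewrite g'T.
have h0 y : 0 <= h y by have [_ /(_ y)/andP[]] := dh.
have rest'_pos y : 0 < rest (i |: T) g' y -> 0 < rest T g y.
  by rewrite rest' => /lt_le_trans; apply; rewrite gerBl.
have h_pos y : 0 < h y -> 0 < rest T g y by move=> /lt_le_trans; apply.
have dg' j : j \in i |: T -> density (g' j).
  by move=> /setU1P[->|jT]; [rewrite g'i|rewrite g'T//; exact: dg].
have mass_g' j : j \in i |: T -> \int[l]_y g' j y = p j.
  by move=> /setU1P[->|jT]; [rewrite g'i|rewrite g'T//; exact: mass_g].
have mean_g' j : j \in i |: T -> \int[l]_y (y * g' j y) = p j * a j.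
  by move=> /setU1P[->|jT]; [rewrite g'i|rewrite g'T//; exact: mean_g].
have rest'0 y : 0 <= rest (i |: T) g' y by rewrite rest' subr_ge0.
have cert' : positive_set (rest (i |: T) g') !=set0 -> forall phi, pwl phi ->
    exists psi, certificate (i |: T) g' phi psi.
  move=> r'_neq0 phi pphi.
  have h_neq0 : positive_set h !=set0.
    apply: contrapT => /set0P/negP/negPn/eqP hE.
    have := p_gt0 i; rewrite -mass_h (_ : \int[l]_y h y = 0) ?ltxx//.
    rewrite -[RHS](mul0r (fine (l setT))) -Rintegral_cst//.
    apply: eq_Rintegral => y _; apply/eqP; rewrite eq_le h0 andbT leNgt.
    by apply/negP => hy; have : positive_set h y by []; rewrite hE.
  have [|s [t [chord_h chord_r]]] := pwl_chord pphi h_neq0 r'_neq0.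
    move=> y1 z y2 hy1 hy2 rz; apply: avoid_h hy1 hy2 _.
    by rewrite /positive_set/= -rest'.
  (* Certify the maximum of phi and its chord over the hull of h. *)
  have pphi' := pwl_max s t pphi.
  have [psi [ppsi phi_psi psi_rest psi_g]] := cert r_neq0 _ pphi'.
  exists psi; split=> //.
  - by move=> y; apply: le_trans (phi_psi y); rewrite le_max lexx.
  - move=> y ry; rewrite psi_rest ?max_l//; [exact: chord_r|exact: rest'_pos].
  - move=> j /setU1P[->|jT]; last by rewrite g'T//; exact: psi_g.
    (* Where h > 0 the former rest was positive, so psi equals the maximum there, which is the
       chord; against h the chord integrates to its value at the barycentre times the mass. *)
    rewrite g'i (_ : \int[l]_y _ = \int[l]_y ((s * y + t) * h y)).
      rewrite (Rintegral_affine_density _ _ dh mass_h mean_h) ler_pM2l//.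
      by apply: le_trans (phi_psi _); rewrite le_max lexx orbT.
    apply: eq_Rintegral => y _; have [hy|hy] := ltP 0 (h y).
      by rewrite psi_rest ?max_r//; [exact: chord_h|exact: h_pos].
    by rewrite (_ : h y = 0) ?mulr0//; apply/eqP; rewrite eq_le hy h0.
exists g'; split=> //.
- move=> j /setU1P[->|jT].
    rewrite g'i => y1 z y2 hy1 hy2; rewrite /positive_set/= rest'.
    exact: avoid_h.
  by rewrite g'T// => y1 z y2 gy1 gy2 /rest'_pos; exact: (avoid_rest _ jT).
- have aT j : j \in T -> avoids_hull (positive_set (g' j)) (positive_set (g' i)).
    by move=> jT; rewrite g'T// g'i => y1 z y2 gy1 gy2 /h_pos; exact: (avoid_rest _ jT).
  move=> j k /setU1P[->|jT] /setU1P[->|kT]; first by rewrite eqxx.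
  + by move=> _; right; exact: aT.
  + by move=> _; left; exact: aT.
  + by rewrite (g'T _ jT) (g'T _ kT); exact: avoid.
- move=> c cu phi k pphi ck.
  pose D j := \int[l]_y (phi y * k j y) - \int[l]_y (phi y * g' j y).
  have D0 : 0 <= \sum_(j in i |: T) D j.
    by apply: certificate_dominates => // ?; exact: cert'.
  (* One step of Abel summation: [u i] is an admissible threshold for T, since no atom of T has a
     smaller weight. *)
  have -> : \sum_(j in i |: T) (u j - c) * D j =
      \sum_(j in T) (u j - u i) * D j + (u i - c) * \sum_(j in i |: T) D j.
    rewrite !big_setU1//= [(_ * (D i + _))%R]mulrDr addrCA; congr (_ + _).
    rewrite mulr_sumr -big_split/=; apply: eq_bigr => j _; ring.
  apply: addr_ge0; last by rewrite mulr_ge0// subr_ge0 cu// setU11.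
  have := dom (u i) ui phi k pphi ck; congr (_ <= _).
  by apply: eq_bigr => j jT; rewrite /D g'T.
Qed.

(** The last clause records that atoms of larger weight u come first, which is what
    [partial_curtain_step] asks of the next atom. *)
Lemma partial_curtain_ex k : (k <= n)%N -> exists T g, [/\ #|T| = k,
  partial_curtain T g & forall i j, i \in T -> j \notin T -> u j <= u i].
Proof.
elim: k => [_|k ih kn].
  exists (finset.set0 : {set 'I_n}), (fun _ _ => 0); split; first by rewrite cards0.
    have rest1 y : rest (finset.set0 : {set 'I_n}) (fun _ _ => 0) y = 1.
      by rewrite /rest big_set0 subr0.
    split=> [i|i|i|y|i|i j|_ phi pphi|c _ phi g' _ _]; rewrite ?inE//.
    + by rewrite rest1.
    + by exists phi; split=> // i; rewrite inE.
    + by rewrite big_set0.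
  by move=> i j; rewrite inE.
have [T [g [Tk pcT uT]]] := ih (ltnW kn).
have [i0 i0T] : exists i0, i0 \notin T.
  apply/existsP; rewrite -negb_forall; apply/negP => /forallP TT.
  move: kn; rewrite -Tk (_ : T = [set: 'I_n]%SET) ?cardsT ?card_ord ?ltnn//.
  by apply/setP => i; rewrite inE TT.
have [i iT ui] := @arg_maxP _ _ _ i0 (fun i => i \notin T) u i0T.
have [|g' pcg'] := partial_curtain_step pcT iT.
  by move=> j jT; exact: uT.
exists (i |: T), g'; split=> //; first by rewrite cardsU1 iT Tk.
move=> j k' /setU1P[->|jT]; rewrite !inE negb_or => /andP[_ k'T].
  exact: ui.
exact: uT.
Qed.

Lemma curtain_density_ex : exists g, [/\ coupling_density g, curtain_density g &
  forall phi g', pwl phi -> coupling_density g' ->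
    \sum_i u i * \int[l]_y (phi y * g i y) <=
    \sum_i u i * \int[l]_y (phi y * g' i y)].
Proof.
have [T [g [Tn [dg mass_g mean_g rest0 _ avoid _ dom] _]]] :=
  partial_curtain_ex (leqnn n).
have TE : T = [set: 'I_n]%SET.
  by apply/eqP; rewrite eqEcard finset.subsetT Tn cardsT card_ord leqnn.
have iT i : i \in T by rewrite TE inE.
have cg : coupling_density g.
  split=> [i||i|i]; try by [exact: dg|exact: mass_g|exact: mean_g].
  have dr := density_rest dg rest0.
  have := mass_rest dg mass_g; rewrite big_pred0 => [Ir|i]; last by rewrite iT.
  have := Rintegral_ge0_eq0 (L1_density l dr) (aeW _ rest0) Ir.
  apply: filterS => y; rewrite /rest TE => /eqP; rewrite subr_eq0 => /eqP ->.
  by apply: eq_bigl => i; rewrite inE.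
exists g; split=> // [i j ij|phi g' pphi cg']; first exact: avoid.
(* Any lower bound of the weights would do: its contribution cancels, because summed over all atoms
   every coupling gives the integral of phi. *)
pose c := - \sum_i `|u i|.
have cu i : i \in T -> c <= u i.
  move=> _; rewrite /c lerNl (bigD1 i)//=; apply: (@le_trans _ _ `|u i|).
    by rewrite -normrN ler_norm.
  by rewrite lerDl sumr_ge0.
have phi1 := pwl_integrable pphi.
have := dom c cu phi g' pphi cg'.
rewrite (eq_bigl xpredT) => [|i]; last by rewrite iT.
under eq_bigr do rewrite mulrBl mulrBr [c * _]mulrBr.
rewrite !sumrB -!mulr_sumr !coupling_density_sum// subrr subr0.
by rewrite subr_ge0.
Qed.

End greedy.
End coupling_densities.

(** * Approximation of convex functions and separation *)

Section pwl_approximation.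
Context {R : realType}.
Implicit Types (I : set R) (psi : R -> R).

(* The partial maxima of the tangents of psi at the rational points of I. *)
Lemma convex_pwl_approx I psi : open I -> is_interval I -> I !=set0 ->
  convex_on I psi -> exists phi : nat -> R -> R,
  [/\ forall n, pwl (phi n), forall n y, I y -> phi n y <= psi y,
      forall n y, phi 0%N y <= phi n y &
      forall y, I y -> phi ^~ y @ \oo --> psi y].
Proof.
move=> oI iI [x0 Ix0] psic.
have /choice[sl slP] x : exists s, I x -> forall y, I y -> psi x + s * (y - x) <= psi y.
  have [Ix|nIx] := pselect (I x); last by exists 0.
  by have [s sP] := convex_support oI psic Ix; exists s.
(* Enumerates the rational points of I; x0 stands in for codes of no rational or of one outside
   I. *)
pose pt k : R := if unpickle k is Some q then
  if `[< I (ratr q) >] then ratr q else x0 else x0.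
have Ipt k : I (pt k).
  by rewrite /pt; case: unpickle => // q; case: asboolP.
pose tg x y := sl x * y + (psi x - sl x * x).
have tgE x y : tg x y = psi x + sl x * (y - x) by rewrite /tg; ring.
have tg_le x y : I x -> I y -> tg x y <= psi y.
  by move=> Ix Iy; rewrite tgE; exact: slP.
pose fix phi n : R -> R := if n is n'.+1 then
  fun y => Num.max (phi n' y) (tg (pt n') y) else tg x0.
have phi_tg k n y : (k < n)%N -> tg (pt k) y <= phi n y.
  elim: n => // n ih; rewrite ltnS leq_eqVlt => /predU1P[->|kn] /=.
    by rewrite le_max lexx orbT.
  by rewrite le_max ih.
have phi_le n y : I y -> phi n y <= psi y.
  move=> Iy; elim: n => [|n ih] /=; first exact: tg_le.
  by rewrite ge_max ih/= tg_le.
exists phi; split=> //.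
- by elim=> [|n ih]; [exact: pwl_affine|exact: pwl_max].
- by elim=> [|n ih] y //=; rewrite le_max ih.
move=> y Iy; apply/cvgrPdist_lt => e e0.
have [q0 [_ [Iq0 _ q0y _]]] := open_itv_around oI Iy.
(* The tangent at q < y falls short of psi y by at most [(y - q) * (sl y - sl q)]. Slopes increase,
   so q0 < q bounds the second factor by C, the added 1 making C positive; q is then chosen within e
   / C of y. *)
pose C := `|sl y - sl q0| + 1.
have C0 : 0 < C by rewrite ltr_wpDl.
have max_lt : Num.max q0 (y - e / C) < y.
  by rewrite gt_max q0y/= gtrBl divr_gt0.
have [q] := rat_in_itvoo max_lt.
rewrite in_itv/= gt_max -andbA => /and3P[q0q yq qy].
have Iq : I (ratr q) by apply: iI Iq0 Iy _ _; rewrite !ltW.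
near=> n.
have qn : (pickle q < n)%N by near: n; exact: nbhs_infty_gt.
have := phi_tg _ _ y qn; rewrite /pt pickleK asboolT// tgE => le1.
rewrite ger0_norm ?subr_ge0 ?phi_le// ltrBlDr -ltrBlDl; apply: lt_le_trans le1.
have le2 := slP _ Iy _ Iq.
have sl_q : sl q0 <= sl (ratr q).
  have := slP _ Iq _ Iq0; have := slP _ Iq0 _ Iq.
  have : 0 < ratr q - q0 by rewrite subr_gt0.
  move: (ratr q) => x; nra.
have yq' : (y - ratr q) * C < e by rewrite -ltr_pdivlMr// ltrBlDl -ltrBlDr.
have qy0 : 0 < y - ratr q by rewrite subr_gt0.
have slC : sl y - sl (ratr q) <= C.
  have := ler_norm (sl y - sl q0); rewrite /C; lra.
have : (y - ratr q) * (sl y - sl (ratr q)) <= (y - ratr q) * C.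
  by rewrite ler_pM2l.
move: le2 yq'; move: (ratr q : R) => x; clear; lra.
Unshelve. all: by end_near.
Qed.

End pwl_approximation.

Section convex_domination.
Context {R : realType} (l : probability R R) (I : set R).
Hypothesis l_mean : l.-integrable setT (EFin \o (@id R)).
Hypotheses (I_open : open I) (I_itv : is_interval I) (I_neq0 : I !=set0).
Hypothesis lI : l I = 1%E.
Implicit Types (psi f g : R -> R).

Let mI : measurable I. Proof. exact: open_measurable. Qed.

Lemma ae_in_I : {ae l, forall y, I y}.
Proof.
exists (~` I); split=> //; first exact: measurableC.
by rewrite probability_setC// lI subee.
Qed.

Lemma convex_measurable psi : convex_on I psi -> measurable_fun setT (psi \_ I).
Proof.
move=> psic; have [phi [pphi _ _ phi_cvg]] := convex_pwl_approx I_open I_itv I_neq0 psic.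
apply/(measurable_restrict psi mI measurableT); rewrite setTI.
apply: (@measurable_fun_cvg _ _ _ _ phi) => // m.
apply: measurable_funTS; exact: L1_measurable (pwl_integrable l_mean (pphi m)).
Qed.

(** The assumption controls the positive part. The negative part is bounded by the absolute value of
    an affine minorant, integrable because l has a mean. *)
Lemma convex_integrable psi : convex_on I psi ->
  (\int[l]_(x in I) (psi^\+ x)%:E < +oo)%E ->
  l.-integrable setT (EFin \o psi \_ I).
Proof.
move=> psic psi_fin; have mpsi := convex_measurable psic.
have [phi [pphi phi_le _ _]] := convex_pwl_approx I_open I_itv I_neq0 psic.
have posE : (psi^\+ \_ I) = (psi \_ I)^\+.
  apply/funext => y; rewrite /funrpos /patch; case: ifP => //.
  by rewrite maxxx.
have pos1 : l.-integrable setT (EFin \o psi^\+ \_ I).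
  apply/integrableP; split.
    by apply/measurable_EFinP; rewrite posE; exact: measurable_funrpos.
  move: psi_fin; rewrite integral_mkcond; congr (_ < _)%E.
  apply: eq_integral => y _; rewrite restrict_EFin/= ger0_norm//.
  by rewrite /patch; case: ifP.
have phi1 := L1_norm (pwl_integrable l_mean (pphi 0%N)).
apply: L1_dominated mpsi (L1D pos1 phi1) _ => y; rewrite /patch.
case: ifPn => [/set_mem Iy|_]; last by rewrite normr0 add0r.
have := phi_le 0%N y Iy; have := ler_norm (- phi 0%N y); rewrite normrN.
rewrite /funrpos; have [h0|h0] := leP (psi y) 0.
  by rewrite (ler0_norm h0) add0r; lra.
by rewrite (gtr0_norm h0) lerDl.
Qed.

(** The weights u may have any sign, so one-sided bounds do not pass through the sums and each
    integral has to converge. On I the approximants lie between [phi 0] and psi, which gives one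
    integrable bound for all of them. *)
Lemma convex_dominates (J : finType) (u : J -> R) (g g' : J -> R -> R) psi :
  convex_on I psi -> l.-integrable setT (EFin \o psi \_ I) ->
  (forall i, density (g i)) -> (forall i, density (g' i)) ->
  (forall phi, pwl phi -> \sum_i u i * \int[l]_y (phi y * g i y) <=
    \sum_i u i * \int[l]_y (phi y * g' i y)) ->
  \sum_i u i * \int[l]_y ((psi \_ I) y * g i y) <=
  \sum_i u i * \int[l]_y ((psi \_ I) y * g' i y).
Proof.
move=> psic psi1 dg dg' dom.
have [phi [pphi phi_le phi0_le phi_cvg]] := convex_pwl_approx I_open I_itv I_neq0 psic.
have phi1 n := pwl_integrable l_mean (pphi n).
have mphi n : measurable_fun setT (phi n \_ I).
  apply/(measurable_restrict _ mI measurableT); rewrite setTI.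
  by apply: measurable_funTS; exact: L1_measurable (phi1 n).
have cvgh h : density h -> \int[l]_y (phi n y * h y) @[n --> \oo] -->
    \int[l]_y ((psi \_ I) y * h y).
  move=> [mh h01].
  (* Off I the approximants are not bounded by psi; restricting them to I does not change the
     integrals, as l is carried by I. *)
  have -> : (fun n => \int[l]_y (phi n y * h y)) =
      fun n => \int[l]_y ((phi n \_ I) y * h y).
    apply/funext => n; apply: Rintegral_ae.
    - by apply: measurable_funM => //; exact: L1_measurable (phi1 n).
    - exact: measurable_funM.
    - by apply: filterS ae_in_I => y Iy; rewrite /patch mem_set.
  apply: (@Rintegral_cvg _ _ _ _ _ _ (fun y => `|phi 0%N y| + `|(psi \_ I) y|)).
  - by move=> n; exact: measurable_funM.
  - by apply: measurable_funM => //; exact: convex_measurable.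
  - by apply: L1D; exact: L1_norm.
  - move=> n y; have /andP[h0 h1] := h01 y.
    rewrite normrM (ger0_norm h0).
    apply: (@le_trans _ _ `|(phi n \_ I) y|); first by rewrite ler_piMr.
    rewrite /patch; case: ifPn => [/set_mem Iy|_]; last by rewrite normr0 addr_ge0.
    have le1 := phi0_le n y; have le2 := phi_le n y Iy.
    have le3 := ler_norm (psi y); have le4 := ler_norm (- phi 0%N y).
    rewrite normrN in le4; have := normr_ge0 (psi y); have := normr_ge0 (phi 0%N y).
    by rewrite ler_norml => h2 h3; apply/andP; split; lra.
  - move=> y; apply: cvgM; last exact: cvg_cst.
    rewrite /patch; case: ifPn => [/set_mem Iy|_]; last exact: cvg_cst.
    exact: phi_cvg.
have cvgs k : (forall i, density (k i)) ->
    \sum_i u i * \int[l]_y (phi n y * k i y) @[n --> \oo] -->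
    \sum_i u i * \int[l]_y ((psi \_ I) y * k i y).
  move=> dk; apply: (@cvg_sumr _ _ _ _ _ _
    (fun i n => u i * \int[l]_y (phi n y * k i y))).
  by move=> i; apply: cvgM; [exact: cvg_cst|exact: cvgh].
apply: (ler_cvg_to (cvgs _ dg) (cvgs _ dg')).
by apply: nearW => n; exact: dom.
Qed.

End convex_domination.

(** * Separation from the convex hull of finitely many points *)

Section separation.
Context {R : realType}.

Definition simplex N : set 'rV[R]_N :=
  [set r | (forall j, 0 <= r ord0 j) /\ \sum_j r ord0 j = 1].

Lemma simplex_compact N : compact (@simplex N).
Proof.
have cbox : compact [set r : 'rV[R]_N | forall j, r ord0 j \in `[(0 : R), 1]].
  apply: (@rV_compact _ _ (fun=> `[(0 : R), 1]%classic)) => _.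
  exact: segment_compact.
have csum : closed [set r : 'rV[R]_N | \sum_j r ord0 j = 1].
  have sum_cont : continuous (fun r : 'rV[R]_N => \sum_j r ord0 j).
    move=> r; apply: (@cvg_sumr _ _ (nbhs r) _ _ _
      (fun j (r : 'rV[R]_N) => r ord0 j)) => j.
    exact: coord_continuous.
  have /continuous_closedP h := sum_cont.
  exact: h [set x | x = 1] (@closed_eq _ 1).
have := compact_closedI cbox csum; congr compact.
apply/seteqP; split=> r [r0 r1]; split=> // j.
  by have := r0 j; rewrite /= in_itv/= => /andP[].
by rewrite /= in_itv/= r0/= -r1 (bigD1 j)//= lerDl sumr_ge0.
Qed.

(* Use w := x - y, where y is the point of the hull nearest to x. *)
Lemma convex_hull_separation n N (c : 'I_N -> 'rV[R]_n) (x : 'rV[R]_n) :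
  (forall w : 'I_n -> R, exists j,
    \sum_i w i * x ord0 i <= \sum_i w i * c j ord0 i) ->
  exists r : 'I_N -> R, [/\ forall j, 0 <= r j, \sum_j r j = 1 &
    x = \sum_j r j *: c j].
Proof.
(* The zero weight vector yields an index, so the simplex is not empty. *)
move=> sep; have [j0 _] := sep (fun=> 0).
pose y (r : 'rV[R]_N) i := \sum_j r ord0 j * c j ord0 i.
pose F (r : 'rV[R]_N) := \sum_i (x ord0 i - y r i) ^+ 2.
have F_cont : continuous F.
  have y_cont i r : y r i @[r --> nbhs r] --> y r i.
    apply: (@cvg_sumr _ _ (nbhs r) _ _ _
      (fun j (r : 'rV[R]_N) => r ord0 j * c j ord0 i)) => j.
    by apply: cvgM; [exact: coord_continuous|exact: cvg_cst].
  move=> r; apply: (@cvg_sumr _ _ (nbhs r) _ _ _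
    (fun i r => (x ord0 i - y r i) ^+ 2)) => i.
  by rewrite expr2; apply: cvgM; apply: cvgB; (exact: cvg_cst || exact: y_cont).
have S0 : @simplex N !=set0.
  exists (\row_j (j == j0)%:R); split=> [j|]; first by rewrite mxE ler0n.
  under eq_bigr do rewrite mxE.
  by rewrite (bigD1 j0)//= eqxx big1 ?addr0// => j /negbTE ->.
have [r /set_mem[r0 r1] rmin] := compact_EVT_min S0 (@simplex_compact N)
  (continuous_subspaceT F_cont).
pose w i := x ord0 i - y r i.
have [j wj] := sep w.
pose d i := c j ord0 i - y r i.
pose W := \sum_i w i ^+ 2.
have wd : W <= \sum_i w i * d i.
  have -> : W = \sum_i w i * x ord0 i - \sum_i w i * y r i.
    by rewrite -sumrB; apply: eq_bigr => i _; rewrite /w; ring.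
  have -> : \sum_i w i * d i = \sum_i w i * c j ord0 i - \sum_i w i * y r i.
    by rewrite -sumrB; apply: eq_bigr => i _; rewrite /d; ring.
  by rewrite lerD2r.
(* Moving from the nearest point by a fraction t towards [c j] cannot shorten the distance to x;
   expanding the square and using [wd] gives the bound. *)
have step t : 0 <= t <= 1 -> 2 * t * W <= t ^+ 2 * \sum_i d i ^+ 2.
  move=> /andP[t0 t1].
  pose r' : 'rV[R]_N := \row_k ((1 - t) * r ord0 k + t * (k == j)%:R).
  have sum_j (e : 'I_N -> R) : \sum_k (k == j)%:R * e k = e j.
    rewrite (bigD1 j)//= eqxx mul1r big1 ?addr0// => k /negbTE ->.
    by rewrite mul0r.
  have r'S : simplex r'.
    split=> [k|].
      by rewrite mxE addr_ge0// mulr_ge0// subr_ge0.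
    under eq_bigr do rewrite mxE.
    rewrite big_split/= -!mulr_sumr r1.
    have := sum_j (fun=> 1); under eq_bigr do rewrite mulr1.
    by move=> ->; ring.
  have y' i : y r' i = y r i + t * d i.
    rewrite /d /y.
    under eq_bigr do rewrite mxE mulrDl -!mulrA.
    rewrite big_split/= -!mulr_sumr (sum_j (fun k => c k ord0 i)).
    by move: (\sum_k _) => S; ring.
  have := rmin _ (mem_set r'S); rewrite /F.
  have -> : \sum_i (x ord0 i - y r' i) ^+ 2 =
      W - 2 * t * (\sum_i w i * d i) + t ^+ 2 * \sum_i d i ^+ 2.
    rewrite !mulr_sumr -sumrB -big_split/=; apply: eq_bigr => i _.
    by rewrite y' /w; ring.
  rewrite -/(W) => h.
  have : 2 * t * W <= 2 * t * \sum_i w i * d i.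
    by rewrite ler_wpM2l// mulr_ge0.
  move: h; rewrite -/W; lra.
pose D := \sum_i d i ^+ 2.
have D0 : 0 <= D by rewrite sumr_ge0// => i _; rewrite sqr_ge0.
have W0 : 0 <= W by rewrite sumr_ge0// => i _; rewrite sqr_ge0.
have WE : W = 0.
  apply/eqP; rewrite eq_le W0 andbT leNgt; apply/negP => Wpos.
  (* This t is at most 1 and satisfies t * D <= W, whereas [step] yields 2 * W <= t * D. *)
  pose t := W / (W + D).
  have WD : 0 < W + D by rewrite ltr_pwDl.
  have tE : t * (W + D) = W by rewrite /t divfK// gt_eqF.
  have t0 : 0 < t by rewrite divr_gt0.
  have t1 : t <= 1 by rewrite ler_pdivrMr// mul1r lerDl.
  have := step t; rewrite (ltW t0) t1 => /(_ isT); rewrite -/D => h.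
  have : 2 * W <= t * D.
    rewrite -(ler_pM2l t0) [leLHS](_ : _ = 2 * t * W); last by ring.
    by rewrite [leRHS](_ : _ = t ^+ 2 * D)//; ring.
  have : t * D <= W by rewrite -[leRHS]tE ler_pM2l// lerDr.
  by move: Wpos; clear; lra.
exists (fun j => r ord0 j); split=> //.
apply/rowP => i; rewrite summxE.
have /eqP := WE; rewrite psumr_eq0 => [|k _]; last exact: sqr_ge0.
move=> /allP/(_ i (mem_index_enum _)); rewrite sqrf_eq0 subr_eq0 => /eqP ->.
by apply: eq_bigr => k _; rewrite mxE.
Qed.

End separation.

(** * Transports and densities *)

Section image_density.
Context d (T : measurableType d) (R : realType) (mu : {measure set T -> \bar R}).
Context d' (T' : measurableType d') (l : {measure set T' -> \bar R}).
Variables (D : set T) (phi : T -> T') (g : T' -> R).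
Hypotheses (mD : measurable D) (mphi : measurable_fun setT phi).
Hypotheses (mg : measurable_fun setT g) (g0 : forall y, 0 <= g y).
Hypothesis mu_density : forall B, measurable B ->
  mu (D `&` phi @^-1` B) = (\int[l]_(y in B) (g y)%:E)%E.

Import HBNNSimple.

Let mphiV B : measurable B -> measurable (phi @^-1` B).
Proof. by move=> mB; rewrite -[X in measurable X]setTI; exact: mphi. Qed.

Let integral_image_density_nnsfun (k : {nnsfun T' >-> R}) :
  (\int[mu]_(z in D) (k (phi z))%:E = \int[l]_y (k y * g y)%:E)%E.
Proof.
set s := finmap.enum_fset (fset_set (k @` setT)).
have kE y : k y = \sum_(i < size s) (s`_i * \1_(k @^-1` [set s`_i]) y).
  exact: fimfunEord.
have s0 i : (i < size s)%N -> 0 <= s`_i.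
  move=> /(mem_nth 0); rewrite in_fset_set//= inE => -[y _ <-].
  exact: fun_ge0.
have mk i : measurable (k @^-1` [set s`_i]) by exact: measurable_sfunP.
have e1 z : ((k (phi z))%:E = \sum_(i < size s)
    (s`_i)%:E * (\1_(phi @^-1` (k @^-1` [set s`_i])) z)%:E)%E.
  by rewrite kE -sumEFin; apply: eq_bigr => i _; rewrite EFinM.
under eq_integral do rewrite e1.
have e2 y : ((k y * g y)%:E = \sum_(i < size s)
    (s`_i)%:E * ((g y)%:E * (\1_(k @^-1` [set s`_i]) y)%:E))%E.
  by rewrite kE mulr_suml -sumEFin; apply: eq_bigr => i _;
    rewrite -!EFinM; congr EFin; ring.
under [RHS]eq_integral do rewrite e2.
have mind i : measurable_fun setT
    (fun y => ((g y)%:E * (\1_(k @^-1` [set s`_i]) y)%:E)%E).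
  by apply: emeasurable_funM; apply/measurable_EFinP => //; exact: measurable_indic.
rewrite ge0_integral_sum//; first last.
- by move=> i z _; rewrite mule_ge0 ?lee_fin ?s0.
- move=> i; apply: measurable_funeM; apply/measurable_EFinP.
  by apply: measurable_indic; exact: mphiV.
rewrite ge0_integral_sum//; first last.
- by move=> i y _; rewrite !mule_ge0 ?lee_fin ?s0.
- by move=> i; exact: measurable_funeM.
apply: eq_bigr => i _; rewrite ge0_integralZl ?lee_fin ?s0//; last first.
  by apply/measurable_EFinP; apply: measurable_indic; exact: mphiV.
rewrite ge0_integralZl ?lee_fin ?s0//; last first.
  by move=> y _; rewrite mule_ge0 ?lee_fin.
congr (_ * _)%E; rewrite integral_indic//; last exact: mphiV.
rewrite setIC mu_density// integral_mkcond; apply: eq_integral => y _.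
by rewrite epatch_indic.
Qed.

Lemma ge0_integral_image_density (h : T' -> R) : measurable_fun setT h ->
  (forall y, 0 <= h y) ->
  (\int[mu]_(z in D) (h (phi z))%:E = \int[l]_y (h y * g y)%:E)%E.
Proof.
move=> mh h0; have mh' : measurable_fun setT (EFin \o h) by exact/measurable_EFinP.
pose k := nnsfun_approx measurableT mh'.
have hE y : (h y)%:E = limn (fun n => (k n y)%:E).
  apply/esym/cvg_lim => //; apply: cvg_nnsfun_approx => // x _.
  by rewrite lee_fin.
have knd y : {homo (fun n => k n y) : m n / (m <= n)%N >-> m <= n}.
  by move=> m n mn; exact/lefP/nd_nnsfun_approx.
have -> : (\int[mu]_(z in D) (h (phi z))%:E =
    limn (fun n => \int[mu]_(z in D) (k n (phi z))%:E))%E.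
  under eq_integral do rewrite hE.
  apply: monotone_convergence => //.
  - move=> n; apply/measurable_EFinP; apply: measurable_funTS.
    by apply: measurableT_comp => //; exact: measurable_funP.
  - by move=> n z _; rewrite lee_fin.
  - by move=> z _ m n mn; rewrite lee_fin knd.
have -> : (\int[l]_y (h y * g y)%:E = limn (fun n => \int[l]_y (k n y * g y)%:E))%E.
  have e y : (h y * g y)%:E = limn (fun n => (k n y * g y)%:E).
    apply/esym/cvg_lim => //; rewrite EFinM.
    under eq_fun do rewrite EFinM.
    apply: cvgeZr => //; apply: cvg_nnsfun_approx => // x _.
    by rewrite lee_fin.
  under eq_integral do rewrite e.
  apply: monotone_convergence => //.
  - by move=> n; apply/measurable_EFinP; apply: measurable_funM => //;
      exact: measurable_funP.
  - by move=> n z _; rewrite lee_fin mulr_ge0.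
  - by move=> z _ m n mn; rewrite lee_fin ler_wpM2r// knd.
by congr (limn _); apply/funext => n; exact: integral_image_density_nnsfun.
Qed.

(** By [mu_density], g is the density with respect to l of the image under phi of mu restricted to
    D. It is applied to a fibre with the second projection, and to a conditional law on I with the
    identity. *)
Lemma integral_image_density (h : T' -> R) : measurable_fun setT h ->
  (\int[mu]_(z in D) (h (phi z))%:E = \int[l]_y (h y * g y)%:E)%E.
Proof.
move=> mh; rewrite integralE [RHS]integralE; congr (_ - _)%E.
  transitivity (\int[mu]_(z in D) (h^\+ (phi z))%:E)%E.
    by apply: eq_integral => z _; rewrite funeposE /funrpos EFin_max.
  rewrite ge0_integral_image_density//; last exact: measurable_funrpos.
  apply: eq_integral => y _; rewrite funeposE /funrpos -EFin_max; congr EFin.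
  by rewrite maxr_pMl// mul0r.
transitivity (\int[mu]_(z in D) (h^\- (phi z))%:E)%E.
  by apply: eq_integral => z _; rewrite funenegE /funrneg EFin_max.
rewrite ge0_integral_image_density//; last exact: measurable_funrneg.
apply: eq_integral => y _; rewrite funenegE /funrneg -EFinN -EFin_max; congr EFin.
by rewrite maxr_pMl// mul0r mulNr.
Qed.

Lemma integrable_image_density (h : T' -> R) : measurable_fun setT h ->
  l.-integrable setT (EFin \o (fun y => h y * g y)) ->
  mu.-integrable D (fun z => (h (phi z))%:E).
Proof.
move=> mh /integrableP[_ fin]; apply/integrableP; split.
  by apply/measurable_EFinP; apply: measurable_funTS; exact: measurableT_comp.
apply: le_lt_trans fin.
have mnh : measurable_fun setT (fun y => `|h y|) by exact: measurableT_comp.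
rewrite (ge0_integral_image_density mnh)// le_eqVlt; apply/orP; left; apply/eqP.
by apply: eq_integral => y _; rewrite /= normrM (ger0_norm (g0 y)).
Qed.

End image_density.

(** Finiteness of a set of probabilities is about equality of packed records. Once the underlying
    functions agree, the other fields are proofs, equal by proof irrelevance. *)
Lemma probability_eq d (T : measurableType d) (R : realType)
    (P Q : probability T R) : (forall A, P A = Q A) -> P = Q.
Proof.
move=> PQ; have {PQ} : (P : set T -> \bar R) = Q by apply/funext.
case: P => P cP; case: Q => Q cQ /= PQ; subst Q; f_equal.
case: cP => c1 m1 s1 sf1 f1 sp1 p1; case: cQ => c2 m2 s2 sf2 f2 sp2 p2.
have ec : c1 = c2.
  by case: c1 {m1} => ? ?; case: c2 {m2} => ? ?; f_equal; exact: Prop_irrelevance.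
subst c2.
have -> : m1 = m2 by case: m1 => ?; case: m2 => ?; f_equal; exact: Prop_irrelevance.
have -> : s1 = s2 by case: s1 => ?; case: s2 => ?; f_equal; exact: Prop_irrelevance.
have -> : sf1 = sf2 by case: sf1 => ?; case: sf2 => ?; f_equal; exact: Prop_irrelevance.
have -> : f1 = f2 by case: f1 => ?; case: f2 => ?; f_equal; exact: Prop_irrelevance.
have -> : sp1 = sp2 by case: sp1 => ?; case: sp2 => ?; f_equal; exact: Prop_irrelevance.
by have -> : p1 = p2 by case: p1 => ?; case: p2 => ?; f_equal; exact: Prop_irrelevance.
Qed.

Section finite_support.
Context {R : realType} (I : set R) (l1 : probability R R).
Context (n : nat) (a : 'I_n -> R).
Hypotheses (I_open : open I) (l1I : l1 I = 1%E) (a_inj : injective a).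
Hypothesis l1_supp : support_in I l1 = range a.

Lemma atom_in i : I (a i).
Proof.
have : range a (a i) by exists i.
by rewrite -l1_supp => -[].
Qed.

Lemma measurable_atoms (P : set 'I_n) : measurable (a @` P).
Proof.
apply: countable_measurable; first by move=> t; exact: measurable_set1.
by apply: finite_set_countable; apply: finite_image; exact: finite_finset.
Qed.

(** A point of I outside the support has a null neighbourhood, hence lies in a null interval with
    rational endpoints, and there are countably many of these. *)
Lemma null_off_support : l1 (~` range a) = 0%E.
Proof.
apply: measure_negligible; first by apply: measurableC; exact: measurable_atoms.
pose N k : set R := if unpickle k is Some (q, r) then
  if l1 `]ratr q, ratr r[%classic == 0%E then `]ratr q, ratr r[%classic
  else set0 else set0.
have N0 k : l1.-negligible (N k).
  rewrite /N; case: unpickle => [[q r]|]; last exact: negligible_set0.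
  case: ifPn => [/eqP h|_]; last exact: negligible_set0.
  exact/negligibleP.
have l1CI : l1 (~` I) = 0%E.
  by rewrite probability_setC ?l1I ?subee//; exact: open_measurable.
have nI : l1.-negligible (~` I).
  by apply/negligibleP => //; apply: measurableC; exact: open_measurable.
apply: negligibleS (negligibleU nI (negligible_bigcup N0)) => x nax.
have [Ix|nIx] := pselect (I x); [right|by left].
have [U [oU Ux U0]] : exists U, [/\ open U, U x & l1 U = 0%E].
  apply: contrapT => nU; apply: nax; rewrite -l1_supp; split=> // U oU Ux.
  by rewrite measure_gt0; apply/eqP => U0; apply: nU; exists U.
have [e /= e0 eU] := (iffLR (nbhs_ballP _ _)) (open_nbhs_nbhs (conj oU Ux)).
have [q] : exists q : rat, ratr q \in `](x - e), x[%R.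
  by apply: rat_in_itvoo; rewrite gtrBl.
have [r] : exists q : rat, ratr q \in `]x, (x + e)[%R.
  by apply: rat_in_itvoo; rewrite ltrDl.
rewrite !in_itv/= => /andP[xr re] /andP[eq qx].
have qrU : `]ratr q, ratr r[%classic `<=` U.
  move=> y /=; rewrite in_itv/= => /andP[qy yr]; apply: eU.
  by rewrite /ball/= ltr_norml; apply/andP; split; lra.
have qr0 : l1 `]ratr q, ratr r[%classic = 0%E.
  by apply: subset_measure0 qrU U0 => //; exact: open_measurable.
have NE : N (pickle (q, r)) = `]ratr q, ratr r[%classic.
  by rewrite /N pickleK qr0 eqxx.
exists (pickle (q, r)); first exact: Logic.I.
by rewrite NE /= in_itv/= qx.
Qed.

(** Removing the finitely many other atoms from the line leaves an open neighbourhood of [a i], of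
    positive measure; off the support it carries nothing, so its mass sits at [a i]. *)
Lemma atom_gt0 i : (0 < l1 [set a i])%E.
Proof.
have : range a (a i) by exists i.
rewrite -l1_supp => -[_]; set F := a @` [set j | j != i].
have cF : closed F.
  by apply: (accessible_finite_set_closed.1 _ _) => //;
    [apply: hausdorff_accessible; exact: Rhausdorff
    |apply: finite_image; exact: finite_finset].
move=> /(_ (~` F)) h; apply: (lt_le_trans (h _ _)).
- by rewrite openC.
- by move=> [j /= /eqP ji] /a_inj.
have -> : l1 [set a i] = l1 ([set a i] `|` ~` range a).
  rewrite measureU0//; last exact: null_off_support.
  by apply: measurableC; exact: measurable_atoms.
apply: le_measure; rewrite ?inE.
- by apply: measurableC; exact: measurable_atoms.
- by apply: measurableU => //; apply: measurableC; exact: measurable_atoms.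
move=> x nF; have [[j _ jx]|] := pselect (range a x); [left|by right].
have [<-//|ji] := eqVneq j i.
by exfalso; apply: nF; exists j.
Qed.

Definition atom_mass i := fine (l1 [set a i]).

Lemma atom_massE i : l1 [set a i] = (atom_mass i)%:E.
Proof. by rewrite fineK// fin_num_measure. Qed.

Lemma atom_mass_gt0 i : 0 < atom_mass i.
Proof. by rewrite -lte_fin -atom_massE atom_gt0. Qed.

End finite_support.

Section slices.
Context {R : realType} (n : nat) (a : 'I_n -> R).
Hypothesis a_inj : injective a.
Implicit Types (A : set (R * R)) (nu : probability (R * R)%type R).

Definition atom_fiber i : set (R * R) := fst @^-1` [set a i].

Definition slice A i : set R := [set y | A (a i, y)].

Lemma measurable_fst_preimage (B : set R) :
  measurable B -> measurable (fst @^-1` B : set (R * R)).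
Proof. by move=> mB; rewrite -[X in measurable X]setTI; exact: measurable_fst. Qed.

Lemma measurable_snd_preimage (B : set R) :
  measurable B -> measurable (snd @^-1` B : set (R * R)).
Proof. by move=> mB; rewrite -[X in measurable X]setTI; exact: measurable_snd. Qed.

Lemma measurable_atom_fiber i : measurable (atom_fiber i).
Proof. exact: measurable_fst_preimage. Qed.

Lemma measurable_slice A i : measurable A -> measurable (slice A i).
Proof. by move=> mA; rewrite -[X in measurable X]setTI; exact: pair1_measurable. Qed.

Lemma atom_fiber_slice A i : atom_fiber i `&` snd @^-1` (slice A i) = atom_fiber i `&` A.
Proof. by rewrite /atom_fiber /slice; apply/seteqP; split=> -[x y] /= [-> h]. Qed.

Lemma trivIset_atom_fiber A : trivIset setT (fun i => A `&` atom_fiber i).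
Proof.
apply/trivIsetP => i j _ _ /eqP ij; apply/seteqP; split => // z.
by rewrite /atom_fiber/= => -[[_ e] [_ e']]; apply: ij; apply: a_inj; rewrite -e.
Qed.

Lemma setI_atom_fibers A : A `&` fst @^-1` range a =
  \big[setU/set0]_(i < n) (A `&` atom_fiber i).
Proof.
rewrite -bigcup_seq; apply/seteqP; split => [z [Az [i _ iz]]|z [i _ [Az iz]]].
  by exists i => /=; [exact: mem_index_enum|split].
by split=> //; exists i.
Qed.

End slices.

Lemma integrable_full (R : realType) (l : probability R R) (I : set R) (h : R -> R) :
  measurable I -> l I = 1%E -> measurable_fun setT h ->
  l.-integrable I (EFin \o h) -> l.-integrable setT (EFin \o h).
Proof.
move=> mI lI mh /integrableP[_ fin]; apply/integrableP; split.
  exact/measurable_EFinP.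
have lCI : l (~` I) = 0%E by rewrite probability_setC ?lI ?subee.
apply: le_lt_trans fin; rewrite [leRHS]integral_mkcond.
rewrite le_eqVlt; apply/orP; left; apply/eqP; apply: ge0_ae_eq_integral => //.
- by apply/measurable_EFinP; exact: measurableT_comp.
- apply/(measurable_restrict _ mI measurableT); rewrite setTI.
  by apply/measurable_EFinP; apply: measurable_funTS; exact: measurableT_comp.
- by move=> y _; rewrite /patch; case: ifP => //=.
- exists (~` I); split=> //; first exact: measurableC.
  by apply: subsetC => y Iy _; rewrite /patch mem_set.
Qed.

Lemma fin_num_cond_law (R : realType) (nu : probability (R * R)%type R) (b : R) :
  fin_num_fun (cond_law nu b).
Proof.
move=> B mB; rewrite /cond_law fin_numM// fin_num_measure//.
by apply: measurableI; [exact: measurable_fst_preimage|exact: measurable_snd_preimage].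
Qed.

HB.instance Definition _ (R : realType) (nu : probability (R * R)%type R) (b : R) :=
  Measure_isFinite.Build _ _ _ (cond_law nu b) (fin_num_cond_law nu b).

Section transport_densities.
Context {R : realType} (I : set R) (l1 l2 : probability R R).
Context (n : nat) (a : 'I_n -> R).
Hypotheses (I_open : open I) (l1I : l1 I = 1%E) (l2I : l2 I = 1%E).
Hypotheses (l1_mean : finite_mean I l1) (l2_mean : finite_mean I l2).
Hypotheses (a_inj : injective a) (l1_supp : support_in I l1 = range a).
Implicit Types (nu : probability (R * R)%type R) (g : 'I_n -> R -> R).

Local Notation p := (atom_mass l1 a).
Local Notation M := (martingale_transport I l1 l2).

Let mI : measurable I. Proof. exact: open_measurable. Qed.

Lemma second_mean : l2.-integrable setT (EFin \o (@id R)).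
Proof. by apply: integrable_full mI l2I _ _ => //. Qed.

Lemma first_mean : l1.-integrable setT (EFin \o (@id R)).
Proof. by apply: integrable_full mI l1I _ _ => //. Qed.

Definition represents nu g := forall i B, measurable B ->
  nu (atom_fiber a i `&` snd @^-1` B) = (\int[l2]_(y in B) (g i y)%:E)%E.

Definition first_marginal nu := forall B, measurable B -> nu (fst @^-1` B) = l1 B.

Lemma atom_fiber_mass nu i : first_marginal nu -> nu (atom_fiber a i) = (p i)%:E.
Proof. by move=> nu1; rewrite nu1// atom_massE. Qed.

Lemma null_off_fibers nu : first_marginal nu -> nu (fst @^-1` (~` range a)) = 0%E.
Proof.
move=> nu1; rewrite nu1; first exact: (null_off_support I_open l1I l1_supp).
by apply: measurableC; exact: measurable_atoms.
Qed.

Lemma measure_slices nu A : first_marginal nu -> measurable A ->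
  nu A = (\sum_i nu (atom_fiber a i `&` snd @^-1` (slice a A i)))%E.
Proof.
move=> nu1 mA; have mr : measurable (fst @^-1` range a : set (R * R)).
  by apply: measurable_fst_preimage; exact: measurable_atoms.
rewrite (measureDI _ mA mr) (@subset_measure0 _ _ _ _ _ (fst @^-1` (~` range a))).
- rewrite add0e setI_atom_fibers measure_bigsetU_ord; last 2 first.
  + by move=> i; apply: measurableI => //; exact: measurable_atom_fiber.
  + exact: trivIset_atom_fiber.
  by apply: eq_bigr => i _; rewrite atom_fiber_slice setIC.
- exact: measurableD.
- by apply: measurable_fst_preimage; apply: measurableC; exact: measurable_atoms.
- by move=> z [].
- exact: null_off_fibers.
Qed.

Lemma integral_fibers nu A h : first_marginal nu -> measurable A ->
  nu.-integrable setT (EFin \o h) ->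
  (\int[nu]_(z in A) (h z)%:E = \sum_i \int[nu]_(z in A `&` atom_fiber a i) (h z)%:E)%E.
Proof.
move=> nu1 mA h1; have mN : measurable (fst @^-1` (~` range a) : set (R * R)).
  by apply: measurable_fst_preimage; apply: measurableC; exact: measurable_atoms.
rewrite (negligible_integral mN mA _ (null_off_fibers nu1)); last first.
  exact: integrableS h1.
have -> : A `\` fst @^-1` (~` range a) = A `&` fst @^-1` range a.
  by rewrite setDE -preimage_setC setCK.
rewrite setI_atom_fibers integral_bigsetU_EFin//.
- by move=> i; apply: measurableI => //; exact: measurable_atom_fiber.
- exact: index_enum_uniq.
- by apply: (@sub_trivIset _ _ _ setT) => //; exact: trivIset_atom_fiber.
- apply: measurable_funTS; exact: measurable_int h1.
Qed.

Lemma represents_integral nu g i h : represents nu g -> density (g i) ->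
  measurable_fun setT h ->
  (\int[nu]_(z in atom_fiber a i) (h z.2)%:E = \int[l2]_y (h y * g i y)%:E)%E.
Proof.
move=> nug [mg g01] mh; apply: integral_image_density => //.
- exact: measurable_atom_fiber.
- by move=> y; have /andP[] := g01 y.
- by move=> B mB; exact: nug.
Qed.

Lemma represents_mass nu g i : first_marginal nu -> represents nu g ->
  \int[l2]_y g i y = p i.
Proof.
move=> nu1 nug; rewrite /Rintegral -nug// preimage_setT setIT.
by rewrite atom_fiber_mass.
Qed.

(** The densities sum to 1 because the fibres add up to the second marginal l2. The barycentres are
    the martingale property tested on the event that X_1 equals [a i]. *)
Lemma represents_coupling nu g : M nu -> (forall i, density (g i)) ->
  represents nu g -> coupling_density l2 p a g.
Proof.
move=> [_ _ nu1 nu2 [snd1 fst1 _ cond]] dg nug; split=> //.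
- have := @integral_ae_eq _ _ _ l2 setT measurableT
    (fun y => (\sum_i g i y)%:E) (cst 1%E).
  have mS : measurable_fun setT (fun y => \sum_i g i y).
    by apply: measurable_sum => i; case: (dg i).
  case=> [||E _ mE|N h].
  + exact: finite_measure_integrable_cst.
  + exact/measurable_EFinP.
  + rewrite [LHS](_ : _ = l2 E); last by rewrite integral_cst// mul1e.
    rewrite -nu2// (measure_slices nu1); last first.
      exact: measurable_snd_preimage.
    under [RHS]eq_integral do rewrite -sumEFin.
    rewrite ge0_integral_sum//; last 2 first.
    * by move=> i; apply/measurable_EFinP; apply: measurable_funTS; case: (dg i).
    * by move=> i y _; rewrite lee_fin; have [_ /(_ y)/andP[]] := dg i.
    by apply: eq_bigr => i _; rewrite -nug//; congr (nu (_ `&` _)).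
  + by exists N; move: h => [mN N0 h]; split=> //; apply: subset_trans h;
      apply: subsetC => y /(_ Logic.I) []/esym.
- by move=> i; exact: represents_mass nug.
- move=> i.
  have := cond (atom_fiber a i) ltac:(by exists [set a i] => //; rewrite setTI).
  have := represents_integral nug (dg i) (@measurable_id _ R setT).
  rewrite /Rintegral => <- <-.
  rewrite (eq_integral (cst (a i)%:E)); last by move=> z; rewrite inE => /= ->.
  have -> : (\int[nu]_(z in atom_fiber a i) cst (a i)%:E z = (a i * p i)%:E)%E.
    rewrite integral_cst; last exact: measurable_atom_fiber.
    by rewrite EFinM; congr (_ * _)%E; exact: atom_fiber_mass.
  exact: mulrC.
Qed.

Lemma represents_ae nu g g' : (forall i, density (g i)) ->
  (forall i, density (g' i)) -> (forall i, {ae l2, forall y, g i y = g' i y}) ->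
  represents nu g -> represents nu g'.
Proof.
move=> dg dg' gg' nug i B mB; rewrite nug//.
apply: ae_eq_integral => //.
- by apply/measurable_EFinP; apply: measurable_funTS; case: (dg i).
- by apply/measurable_EFinP; apply: measurable_funTS; case: (dg' i).
- by apply: filterS (gg' i) => y -> _.
Qed.

(** The conditional laws are dominated by the second marginal l2; multiplying their Radon-Nikodym
    derivatives by [p i] undoes the normalization. *)
Lemma represents_ex nu : M nu ->
  exists g, (forall i, density (g i)) /\ represents nu g.
Proof.
move=> [_ _ nu1 nu2 _].
have mf i B : measurable B -> measurable (atom_fiber a i `&` snd @^-1` B).
  by move=> mB; apply: measurableI;
    [exact: measurable_atom_fiber|exact: measurable_snd_preimage].
have p0 i : 0 < p i by exact: (atom_mass_gt0 I_open l1I a_inj l1_supp i).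
have pcond i B : ((p i)%:E * cond_law nu (a i) B =
    nu (atom_fiber a i `&` snd @^-1` B))%E.
  rewrite /cond_law -/(atom_fiber a i) atom_fiber_mass//= muleA -EFinM.
  by rewrite divff ?mul1e// gt_eqF.
have dom i : cond_law nu (a i) `<< l2.
  apply/null_content_dominatesP => B mB B0; rewrite /= /cond_law.
  have e : nu (fst @^-1` [set a i] `&` snd @^-1` B) = 0%E.
    apply: (@subset_measure0 _ _ _ _ _ (snd @^-1` B)).
    - exact: (mf i).
    - exact: measurable_snd_preimage.
    - by move=> z [].
    - exact: (etrans (nu2 _ mB) B0).
  by rewrite e mule0.
have /choice[F FP] i : exists F : R -> R, [/\ measurable_fun setT F,
    forall y, 0 <= F y & forall B, measurable B ->
    (\int[l2]_(y in B) (F y)%:E = nu (atom_fiber a i `&` snd @^-1` B))%E].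
  have [f [f0 ffin f1 fint]] := radon_nikodym_sigma_finite (dom i).
  exists (fun y => p i * fine (f y)); split.
  - apply: measurable_funM => //; apply: measurableT_comp => //.
    exact: measurable_int f1.
  - by move=> y; apply: mulr_ge0; [exact: ltW|exact: fine_ge0].
  - move=> B mB; rewrite -pcond fint//.
    have mf1 : measurable_fun B f.
      by apply: measurable_funTS; exact: measurable_int f1.
    rewrite -(ge0_integralZl _ mB mf1 (fun y _ => f0 y)); last by rewrite lee_fin ltW.
    by apply: eq_integral => y _; rewrite EFinM (fineK (ffin y)).
have F1 : {ae l2, forall y, \sum_i F i y = 1}.
  have mS : measurable_fun setT (fun y => \sum_i F i y).
    by apply: measurable_sum => i; case: (FP i).
  have := @integral_ae_eq _ _ _ l2 setT measurableT
    (fun y => (\sum_i F i y)%:E) (cst 1%E).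
  case=> [||E _ mE|N h].
  + exact: finite_measure_integrable_cst.
  + exact/measurable_EFinP.
  + rewrite [LHS](_ : _ = l2 E); last by rewrite integral_cst// mul1e.
    rewrite -nu2// (measure_slices nu1); last first.
      exact: measurable_snd_preimage.
    under [RHS]eq_integral do rewrite -sumEFin.
    rewrite ge0_integral_sum//; last 2 first.
    * by move=> i; apply/measurable_EFinP; apply: measurable_funTS; case: (FP i).
    * by move=> i y _; rewrite lee_fin; have [_ /(_ y)] := FP i.
    by apply: eq_bigr => i _; have [_ _ ->] := FP i.
  + by exists N; move: h => [mN N0 h]; split=> //; apply: subset_trans h;
      apply: subsetC => y /(_ Logic.I) []/esym.
(* The [F i] are nonnegative and sum to 1 almost everywhere, so truncation at 1 alters them on a
   null set only. *)
pose g i y := Num.min (F i y) 1.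
have mg i : measurable_fun setT (g i) by apply: measurable_minr => //; case: (FP i).
have Fg i : {ae l2, forall y, F i y = g i y}.
  apply: filterS F1 => y Fy; rewrite /g min_l// -Fy (bigD1 i)//= lerDl.
  by apply: sumr_ge0 => j _; have [_ /(_ y)] := FP j.
exists g; split=> [i|i B mB].
  split=> // y; rewrite /g le_min ler01 ge_min lexx orbT !andbT.
  by have [_ /(_ y)] := FP i.
have [mF _ <-//] := FP i; apply: ae_eq_integral => //.
- by apply/measurable_EFinP; exact: measurable_funTS.
- by apply/measurable_EFinP; exact: measurable_funTS.
- by apply: filterS (Fg i) => y -> _.
Qed.

Lemma represents_unique nu nu' g g' : M nu -> M nu' ->
  (forall i, density (g i)) -> (forall i, density (g' i)) ->
  represents nu g -> represents nu' g' ->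
  (forall i, {ae l2, forall y, g i y = g' i y}) -> nu = nu'.
Proof.
move=> [z0 _ nu1 _ _] [z0' _ nu1' _ _] dg dg' nug nug' gg'.
apply: probability_eq => A; have [mA|nmA] := pselect (measurable A); last first.
  by rewrite z0// z0'.
rewrite (measure_slices nu1 mA) (measure_slices nu1' mA).
apply: eq_bigr => i _; have mS : measurable (slice a A i) by exact: measurable_slice.
by rewrite nug'// (represents_ae dg dg' gg' nug).
Qed.

Lemma represents_cond_means nu g f i : M nu -> density (g i) -> represents nu g ->
  l2.-integrable setT (EFin \o f \_ I) ->
  cond_means I f a nu ord0 i = (p i)^-1 * \int[l2]_y ((f \_ I) y * g i y).
Proof.
move=> [_ _ nu1 nu2 _] dg nug f1; have [mg g01] := dg.
have p0 : 0 < p i by exact: (atom_mass_gt0 I_open l1I a_inj l1_supp i).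
have mf := L1_measurable f1.
have cond_density B : measurable B ->
    (cond_law nu (a i) (I `&` id @^-1` B) = \int[l2]_(y in B) ((p i)^-1 * g i y)%:E)%E.
  move=> mB; under eq_integral do rewrite EFinM.
  rewrite ge0_integralZl//; last 3 first.
  - by apply/measurable_EFinP; exact: measurable_funTS.
  - by move=> y _; rewrite lee_fin; have /andP[] := g01 y.
  - by rewrite lee_fin invr_ge0 ltW.
  rewrite /cond_law -/(atom_fiber a i) atom_fiber_mass//= -nug//; congr (_ * _)%E.
  have mX : measurable (atom_fiber a i `&` snd @^-1` B).
    by apply: measurableI; [exact: measurable_atom_fiber|exact: measurable_snd_preimage].
  rewrite [RHS](measureDI _ mX (measurable_snd_preimage mI)).
  rewrite [X in (X + _)%E](_ : _ = 0%E).
    rewrite add0e; congr (nu _); apply/seteqP.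
    by split=> z [fz]; [move=> [Iz Bz]|move: fz => [fz Bz] Iz].
  apply: (@subset_measure0 _ _ _ _ _ (snd @^-1` (~` I))).
  - by apply: measurableD => //; exact: measurable_snd_preimage.
  - by apply: measurable_snd_preimage; exact: measurableC.
  - by move=> z [].
  - apply: etrans (nu2 _ (measurableC mI)) _.
    by rewrite probability_setC ?l2I ?subee.
rewrite /cond_means mxE.
transitivity (\int[cond_law nu (a i)]_(y in I) (f \_ I) y).
  by apply: eq_Rintegral => y yI; rewrite /patch yI.
rewrite -RintegralZl//; last exact: L1M.
rewrite /Rintegral; congr fine.
have := @integral_image_density _ _ _ (cond_law nu (a i)) _ _ l2 I id
  (fun y => (p i)^-1 * g i y) mI (@measurable_id _ _ setT) _ _ cond_density (f \_ I) mf.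
move=> -> //.
- by apply: eq_integral => y _; congr EFin; ring.
- by apply: measurable_funM.
- by move=> y; have /andP[? _] := g01 y; rewrite mulr_ge0// invr_ge0 ltW.
Qed.

End transport_densities.

Lemma probability_of_measure d (T : measurableType d) (R : realType)
    (mu : set T -> \bar R) : mu set0 = 0%E -> (forall A, 0 <= mu A)%E ->
  semi_sigma_additive mu -> mu setT = 1%E ->
  exists P : probability T R, forall A, P A = mu A.
Proof.
move=> mu0 mu_ge0 mu_sa mu1.
pose mM := isMeasure.Build _ _ _ mu mu0 mu_ge0 mu_sa.
pose mu' : {measure set T -> \bar R} := HB.pack mu mM.
pose mP := Measure_isProbability.Build _ _ _ mu' mu1.
pose P : probability T R := HB.pack mu mM mP.
by exists P.
Qed.

Section gluing.
Context {R : realType} (l : probability R R) (n : nat) (a : 'I_n -> R).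
Variable g : 'I_n -> R -> R.
Hypotheses (mg : forall i, measurable_fun setT (g i)) (g0 : forall i y, 0 <= g i y).
Hypothesis g1 : {ae l, forall y, \sum_i g i y = 1}.

Lemma gluing_ex : exists nu : probability (R * R)%type R,
  zero_off_measurable nu /\ forall A, measurable A ->
    nu A = (\sum_i \int[l]_(y in slice a A i) (g i y)%:E)%E.
Proof.
(* The value 0 on non-measurable sets selects the representative required by
   [zero_off_measurable]. *)
pose nu (A : set (R * R)) : \bar R :=
  if `[< measurable A >] then (\sum_i \int[l]_(y in slice a A i) (g i y)%:E)%E else 0%E.
have nuE A : measurable A ->
    nu A = (\sum_i \int[l]_(y in slice a A i) (g i y)%:E)%E.
  by move=> mA; rewrite /nu asboolT.
have mgE i : measurable_fun setT (fun y => (g i y)%:E) by exact/measurable_EFinP.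
have g0E i y : (0 <= (g i y)%:E)%E by rewrite lee_fin.
have [||||P PE] := @probability_of_measure _ _ R nu.
- rewrite nuE// big1// => i _.
  by rewrite (_ : slice a set0 i = set0) ?integral_set0.
- move=> A; rewrite /nu; case: asboolP => // _.
  by apply: sume_ge0 => i _; exact: integral_ge0.
- move=> F mF tF mUF; rewrite (nuE _ mUF).
  rewrite [X in X @ _ --> _](_ : _ = fun k => (\sum_i \sum_(0 <= j < k)
      \int[l]_(y in slice a (F j) i) (g i y)%:E)%E); last first.
    by apply/funext => k; rewrite exchange_big; apply: eq_bigr => j _; exact: nuE.
  apply: cvg_nnesum => [i _|i _].
    by apply: nearW => k; apply: sume_ge0 => j _; exact: integral_ge0.
  rewrite (_ : slice a (\bigcup_j F j) i = \bigcup_j slice a (F j) i)//.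
  apply: (semi_sigma_additive_nng_induced (mgE i) (g0E i)).
  + by move=> j; exact: measurable_slice.
  + apply/trivIsetP => j k _ _ jk; apply/seteqP; split=> // y [Fj Fk].
    move/trivIsetP : tF => /(_ j k Logic.I Logic.I jk)/seteqP[+ _].
    by move=> /(_ (a i, y)); apply; split; [exact: Fj|exact: Fk].
  + by apply: bigcup_measurable => j _; exact: measurable_slice.
- rewrite nuE//.
  under eq_bigr do rewrite (_ : slice a setT _ = setT)//.
  rewrite -ge0_integral_sum//.
  rewrite (ge0_ae_eq_integral (g := cst 1%E))//.
  + by rewrite integral_cst// mul1e; exact: probability_setT.
  + under eq_fun do rewrite sumEFin.
    by apply/measurable_EFinP; exact: measurable_sum.
  + by move=> y _; apply: sume_ge0 => i _; exact: g0E.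
  + by apply: filterS g1 => y gy _; rewrite sumEFin gy.
exists P; split=> [A nmA|A mA]; last by rewrite PE nuE.
by rewrite PE /nu; case: asboolP.
Qed.

End gluing.

(** * Curtain transports *)

Section curtain_densities.
Context {R : realType} (I : set R) (l1 l2 : probability R R).
Context (n : nat) (a : 'I_n -> R).
Hypotheses (I_open : open I) (l1I : l1 I = 1%E) (l2I : l2 I = 1%E).
Hypotheses (l1_mean : finite_mean I l1) (l2_mean : finite_mean I l2).
Hypotheses (a_inj : injective a) (l1_supp : support_in I l1 = range a).
Implicit Types (nu : probability (R * R)%type R) (g : 'I_n -> R -> R).

Local Notation p := (atom_mass l1 a).
Local Notation M := (martingale_transport I l1 l2).
Local Notation C := (curtain_transport I l1 l2).

Let mI : measurable I. Proof. exact: open_measurable. Qed.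

Lemma measure_atoms B : measurable B -> l1 B = (\sum_i l1 (B `&` [set a i]))%E.
Proof.
move=> mB; have mr := measurable_atoms a setT.
have e0 : l1 (B `\` range a) = 0%E.
  apply: (@subset_measure0 _ _ _ _ _ (~` range a)).
  - exact: measurableD.
  - exact: measurableC.
  - by move=> z [].
  - exact: (null_off_support I_open l1I l1_supp).
rewrite (measureDI _ mB mr) [X in (X + _)%E](_ : _ = 0%E); last exact: e0.
rewrite add0e -measure_bigsetU_ord.
- congr (l1 _); rewrite -bigcup_seq; apply/seteqP; split.
    by move=> z [Bz [i _ iz]]; exists i => /=; [exact: mem_index_enum|split].
  by move=> z [i _ [Bz zi]]; split=> //; exists i.
- by move=> i; exact: measurableI.
- apply/trivIsetP => i j _ _ /eqP ij; apply/seteqP; split=> // z.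
  by move=> [[_ ->] [_ /a_inj]].
Qed.

(** The densities are glued along the fibres. An event determined by X_1 contains a fibre or misses
    it, so the martingale property reduces to the barycentre of each [g i]. *)
Lemma transport_of_coupling g : coupling_density l2 p a g ->
  exists nu, M nu /\ represents l2 a nu g.
Proof.
move=> [dg g1 mass_g mean_g].
have mg i : measurable_fun setT (g i) by case: (dg i).
have g0 i y : 0 <= g i y by have [_ /(_ y)/andP[]] := dg i.
have [nu [nu0 nuE]] := gluing_ex a mg g0 g1.
have int_g i : (\int[l2]_y (g i y)%:E = (p i)%:E)%E.
  rewrite -mass_g fineK//; apply: integrable_fin_num => //.
  exact: L1_density.
have repr : represents l2 a nu g.
  move=> i B mB; rewrite nuE; last first.
    by apply: measurableI; [exact: measurable_atom_fiber|exact: measurable_snd_preimage].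
  rewrite (bigD1 i)//= big1 ?adde0.
    congr (\int[l2]_(y in _) _)%E; apply/seteqP; split=> [y []//|y By].
    by split.
  move=> j ji; rewrite (_ : slice _ _ _ = set0) ?integral_set0//.
  apply/seteqP; split=> // y [/= /a_inj e _].
  by move: ji; rewrite e eqxx.
have marg1 : first_marginal l1 nu.
  move=> B mB; rewrite nuE; last exact: measurable_fst_preimage.
  rewrite [RHS]measure_atoms//; apply: eq_bigr => i _.
  have [Bi|nBi] := pselect (B (a i)).
    rewrite (_ : slice _ _ _ = setT); last by apply/seteqP; split.
    rewrite int_g (_ : B `&` _ = [set a i]) ?atom_massE//.
    by apply/seteqP; split=> [z []//|z ->].
  rewrite (_ : slice _ _ _ = set0) ?integral_set0; last by apply/seteqP; split.
  have -> : B `&` [set a i] = set0 by apply/seteqP; split=> // z [+ zi]; rewrite [z]zi.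
  exact/esym/measure0.
have marg2 B : measurable B -> nu (snd @^-1` B) = l2 B.
  move=> mB; rewrite nuE; last exact: measurable_snd_preimage.
  transitivity (\int[l2]_(y in B) (\sum_i (g i y)%:E))%E.
    rewrite ge0_integral_sum//.
    - by move=> i; apply/measurable_EFinP; exact: measurable_funTS.
    - by move=> i y _; rewrite lee_fin.
  transitivity (\int[l2]_(y in B) cst 1%E y)%E; last by rewrite integral_cst// mul1e.
  apply: ae_eq_integral => //.
  - apply: measurable_funTS; under eq_fun do rewrite sumEFin.
    by apply/measurable_EFinP; exact: measurable_sum.
  - by apply: filterS g1 => y gy _; rewrite sumEFin gy.
have int1 (l : probability R R) B : measurable B ->
    (\int[l]_(y in B) (cst 1 y : R)%:E = l B)%E.
  by move=> mB; have := integral_cst l mB 1%E; rewrite mul1e.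
have snd1 : nu.-integrable setT (EFin \o snd).
  apply: (@integrable_image_density _ _ _ nu _ _ l2 setT snd (cst 1) _ _ _ _ _ id) => //.
  - by move=> B mB; rewrite setTI int1//; exact: marg2.
  - apply: eq_integrable (second_mean I_open l2I l2_mean) => // y _ /=.
    by rewrite mulr1.
have fst1 : nu.-integrable setT (EFin \o fst).
  apply: (@integrable_image_density _ _ _ nu _ _ l1 setT fst (cst 1) _ _ _ _ _ id) => //.
  - by move=> B mB; rewrite setTI int1//; exact: marg1.
  - apply: eq_integrable (first_mean I_open l1I l1_mean) => // y _ /=.
    by rewrite mulr1.
exists nu; split=> //; split=> //.
  have mII : measurable (I `*` I) by exact: measurableX.
  rewrite nuE// -l2I -(marg2 I)// nuE; last exact: measurable_snd_preimage.
  apply: eq_bigr => i _; congr (\int[l2]_(y in _) _)%E.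
  apply/seteqP; split=> [y []//|y Iy]; split=> //=.
  exact: atom_in l1_supp i.
split=> //.
  by move=> _ B mB; exists B.
move=> A [B mB AE].
have mA : measurable A.
  by rewrite -AE setTI; exact: measurable_fst_preimage.
rewrite (integral_fibers I_open l1I a_inj l1_supp marg1 mA fst1).
rewrite (integral_fibers I_open l1I a_inj l1_supp marg1 mA snd1).
apply: eq_bigr => i _; have [Bi|nBi] := pselect (B (a i)); last first.
  rewrite (_ : A `&` _ = set0) ?integral_set0//.
  apply/seteqP; split=> // z [+ zi]; rewrite -AE => -[_ /=].
  by rewrite [z.1]zi.
rewrite (_ : A `&` _ = atom_fiber a i); last first.
  apply/seteqP; split=> [z []//|z zi]; split=> //.
  by rewrite -AE; split=> //=; rewrite [z.1]zi.
rewrite (represents_integral repr (dg i) (@measurable_id _ R setT)).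
transitivity (p i * a i)%:E.
  rewrite (eq_integral (cst (a i)%:E)); last by move=> z; rewrite inE => /= ->.
  rewrite integral_cst; last exact: measurable_atom_fiber.
  rewrite mulrC EFinM; congr (_ * _)%E.
  exact: atom_fiber_mass.
rewrite -mean_g fineK//; apply: integrable_fin_num => //.
by apply: L1_id_density => //; exact: (second_mean I_open l2I l2_mean).
Qed.

(** The carrier consists of the sets {g i > 0} within I, each placed on its fibre. Six points
    violating the curtain condition would refute both alternatives of [curtain_density] for the two
    atoms involved. *)
Lemma curtain_of_density nu g : M nu -> (forall i, density (g i)) ->
  represents l2 a nu g -> curtain_density g -> C nu.
Proof.
move=> Mnu dg repr curt; have [_ _ nu1 nu2 _] := Mnu; split=> //.
have mg i : measurable_fun setT (g i) by case: (dg i).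
have g0 i y : 0 <= g i y by have [_ /(_ y)/andP[]] := dg i.
pose D i := I `&` positive_set (g i).
have mD i : measurable (D i).
  apply: measurableI => //; rewrite -[positive_set _]setTI.
  by rewrite /positive_set -preimage_itvoy; apply: mg => //; exact: measurable_itv.
pose Gam := \big[setU/set0]_(i < n) (atom_fiber a i `&` snd @^-1` D i).
have GamP z : Gam z <-> exists i, z.1 = a i /\ D i z.2.
  rewrite /Gam -bigcup_seq; split=> [[i _ [zi Di]]|[i [zi Di]]]; exists i => //=.
  exact: mem_index_enum.
have mGam : measurable Gam.
  apply: bigsetU_measurable => i _.
  by apply: measurableI; [exact: measurable_atom_fiber|exact: measurable_snd_preimage].
exists Gam; split=> //.
- move=> z /GamP[i [zi [Iz _]]]; split=> //.
  by rewrite [z.1]zi; exact: atom_in l1_supp i.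
- rewrite (measure_slices I_open l1I a_inj l1_supp nu1 mGam).
  rewrite -(@probability_setT _ _ _ nu).
  rewrite (measure_slices I_open l1I a_inj l1_supp nu1 (@measurableT _ _)).
  apply: eq_bigr => i _.
  have -> : slice a Gam i = D i.
    apply/seteqP; split=> y; last by move=> Dy; apply/GamP; exists i.
    by move=> /GamP[j [/= /a_inj <-]].
  have -> : slice a setT i = setT by apply/seteqP; split.
  rewrite repr// repr// integral_mkcond; apply: ge0_ae_eq_integral => //.
  + apply/(measurable_restrict _ (mD i) measurableT); rewrite setTI.
    by apply/measurable_EFinP; exact: measurable_funTS.
  + by apply/measurable_EFinP.
  + by move=> y _; rewrite /patch; case: ifP => //; rewrite lee_fin.
  + by move=> y _; rewrite lee_fin.
  + apply: filterS (ae_in_I I_open l2I) => y Iy _; rewrite /patch.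
    case: ifPn => // /negP yD; congr EFin; apply/eqP; rewrite eq_le g0/= leNgt.
    by apply/negP => gy; apply: yD; apply/mem_set.
- move=> x y y1 y2 x' y' y1' y2' sub [xx' /andP[y1y' y'y2] /andP[y1'y yy2']].
  have G1 : Gam (x, y) by apply: sub; do 5 left.
  have G2 : Gam (x, y1) by apply: sub; do 4 left; right.
  have G3 : Gam (x, y2) by apply: sub; do 3 left; right.
  have G4 : Gam (x', y') by apply: sub; do 2 left; right.
  have G5 : Gam (x', y1') by apply: sub; left; right.
  have G6 : Gam (x', y2') by apply: sub; right.
  have Gi z w i : a i = z -> Gam (z, w) -> 0 < g i w.
    by move=> <- /GamP[j [/= /a_inj <- []]].
  have /GamP[i [/= /esym xi _]] := G1; have /GamP[j [/= /esym x'j _]] := G4.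
  have ij : i != j by apply: contra xx' => /eqP e; rewrite -xi -x'j e.
  have [h|h] := curt _ _ ij.
    apply: (h y1 y' y2); [exact: Gi G2|exact: Gi G3|exact: Gi G4|].
    by rewrite y1y'.
  apply: (h y1' y y2'); [exact: Gi G5|exact: Gi G6|exact: Gi G1|].
  by rewrite y1'y.
Qed.

Lemma not_avoids_hull (S T : set R) : ~ avoids_hull S T ->
  exists y1 z y2, [/\ S y1, S y2, T z & y1 < z < y2].
Proof.
move=> nST; apply: contrapT => nex; apply: nST => y1 z y2 Sy1 Sy2 Tz yzy.
by apply: nex; exists y1, z, y2.
Qed.

(** An arbitrary version of the densities may be positive off the carrier. Multiplying by the
    indicator of the slice changes it on a null set and puts {g i > 0} inside the carrier, where the
    curtain condition applies. *)
Lemma curtain_density_of nu : C nu -> exists g,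
  [/\ forall i, density (g i), represents l2 a nu g & curtain_density g].
Proof.
move=> [Mnu [Gam [mGam _ nuGam curt]]]; have [_ _ nu1 nu2 _] := Mnu.
have [g [dg repr]] := represents_ex I_open l1I a_inj l1_supp Mnu.
have mS i : measurable (slice a Gam i) by exact: measurable_slice.
pose g' i y := g i y * \1_(slice a Gam i) y.
have nuCGam : nu (~` Gam) = 0%E by rewrite probability_setC// nuGam subee.
have dg' i : density (g' i).
  have [mg g01] := dg i; split.
    by apply: measurable_funM => //; exact: measurable_indic.
  by move=> y; rewrite /g' indicE; case: (_ \in _);
    rewrite ?mulr1 ?mulr0 ?lexx ?ler01.
have gg' i : {ae l2, forall y, g i y = g' i y}.
  have [mg g01] := dg i.
  pose h y := g i y * \1_(~` slice a Gam i) y.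
  have dh : density h.
    split.
      by apply: measurable_funM => //; apply: measurable_indic; exact: measurableC.
    by move=> y; rewrite /h indicE; case: (_ \in _);
      rewrite ?mulr1 ?mulr0 ?lexx ?ler01.
  have Ih : \int[l2]_y h y = 0.
    rewrite /Rintegral.
    transitivity (fine (\int[l2]_(y in ~` slice a Gam i) (g i y)%:E)%E).
      congr fine; rewrite [RHS]integral_mkcond; apply: eq_integral => y _.
      by rewrite epatch_indic EFinM.
    rewrite -repr; last exact: measurableC.
    rewrite (@subset_measure0 _ _ _ _ _ (~` Gam))//.
    - apply: measurableI; first exact: measurable_atom_fiber.
      by apply: measurable_snd_preimage; exact: measurableC.
    - exact: measurableC.
    - move=> -[x y] [/= xi nS] Gxy; apply: nS; rewrite /slice/=.
      by rewrite -xi.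
  have h0 y : 0 <= h y by have [_ /(_ y)/andP[]] := dh.
  have := Rintegral_ge0_eq0 (L1_density l2 dh) (aeW _ h0) Ih.
  apply: filterS => y; rewrite /h /g' !indicE.
  by rewrite in_setC; case: (_ \in _); rewrite /= ?mulr1 ?mulr0.
exists g'; split=> //; first exact: represents_ae repr.
have g'Gam i y : 0 < g' i y -> Gam (a i, y).
  rewrite /g' indicE; case: (boolP (y \in _)) => [/set_mem//|_].
  by rewrite mulr0 ltxx.
move=> i j ij; apply: contrapT => /not_orP[].
move=> /not_avoids_hull[y1 [y' [y2 [/g'Gam G1 /g'Gam G2 /g'Gam G3 lt1]]]].
move=> /not_avoids_hull[y1' [y [y2' [/g'Gam G1' /g'Gam G2' /g'Gam G3' lt2]]]].
apply: (curt (a i) y y1 y2 (a j) y' y1' y2').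
  by move=> z [[[[[]|]|]|]|] ->.
split=> //; apply: contra ij => /eqP /a_inj ->; exact: eqxx.
Qed.

Definition inside g : rel 'I_n := fun j i => (j != i) &&
  `[< ~ avoids_hull (positive_set (g i)) (positive_set (g j)) >].

(** A strictly monotone count stands in for the order itself, so that transports are classified by a
    map between finite types. The count is at most n, hence [inord] does not alter it. *)
Definition depth g i : 'I_n.+1 := inord #|[pred j | inside g j i]|.

Lemma insideP g i j : reflect (j <> i /\ exists y1 z y2,
    [/\ 0 < g i y1, 0 < g i y2, 0 < g j z & y1 < z < y2]) (inside g j i).
Proof.
apply: (iffP andP) => [[/eqP ji /asboolP/not_avoids_hull h]|[/eqP ji h]].
  by split.
split=> //; apply/asboolP => av.
by have [y1 [z [y2 [h1 h2 h3 h4]]]] := h; exact: (av y1 z y2).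
Qed.

(** With j inside i, the curtain condition forbids points of {g i > 0} strictly between two points
    of {g j > 0}. So the two points of i around z enclose w1 and w2 as well, and with them x. The
    case k = i would put the point x of i between w1 and w2. *)
Lemma inside_trans g : curtain_density g -> transitive (inside g).
Proof.
move=> curt j k i /insideP[kj [w1 [x [w2 [gw1 gw2 gx /andP[w1x xw2]]]]]].
move=> /[dup] ji /insideP[/eqP nji [y1 [z [y2 [gy1 gy2 gz /andP[y1z zy2]]]]]].
have av : avoids_hull (positive_set (g j)) (positive_set (g i)).
  have [//|h] := curt _ _ nji.
  by exfalso; apply: (h y1 z y2) => //; rewrite y1z.
have y1w1 : y1 <= w1.
  by rewrite leNgt; apply/negP => h; apply: (av w1 y1 z) => //; rewrite h.
have w2y2 : w2 <= y2.
  by rewrite leNgt; apply/negP => h; apply: (av z y2 w2) => //; rewrite zy2.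
have h1 := le_lt_trans y1w1 w1x; have h2 := lt_le_trans xw2 w2y2.
apply/insideP; split; last by exists y1, x, y2; rewrite h1 h2.
move=> ki; move: gx; rewrite ki => gx.
by apply: (av w1 x w2) => //; rewrite w1x.
Qed.

Lemma depth_lt g i j : curtain_density g -> inside g j i -> (depth g j < depth g i)%N.
Proof.
move=> curt ji; rewrite /depth !inordK; try by rewrite ltnS -[leqRHS]card_ord max_card.
apply: proper_card; apply/properP; split.
  by apply/fintype.subsetP => k; rewrite !inE => kj; exact: inside_trans ji.
by exists j; rewrite !inE// /inside eqxx.
Qed.

(* Induction on the depth: [g i] is determined by the density that the fibers
   of smaller depth leave over. *)
Lemma curtain_density_unique g g' : coupling_density l2 p a g ->
  coupling_density l2 p a g' -> curtain_density g -> curtain_density g' ->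
  (forall i, depth g i = depth g' i) -> forall i, {ae l2, forall y, g i y = g' i y}.
Proof.
move=> cg cg' curt curt' gg' i.
have [m] := ubnP (depth g i); elim: m i => // m ih i; rewrite ltnS => dm.
have lower j : (depth g j < depth g i)%N -> {ae l2, forall y, g j y = g' j y}.
  by move=> ji; apply: ih; exact: leq_trans dm.
(* The other atoms of depth at least that of i. By [depth_lt] none of them lies inside i, which is
   the hull condition of [density_unique]; equal depths make P the same for g'. *)
pose P j := (j != i) && (depth g i <= depth g j)%N.
have [dg g1 mass_g mean_g] := cg; have [dg' g1' mass_g' mean_g'] := cg'.
have pos h : coupling_density l2 p a h -> forall j y, 0 <= h j y.
  by move=> [dh _ _ _] j y; have [_ /(_ y)/andP[]] := dh j.
have avoids h : coupling_density l2 p a h -> curtain_density h ->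
    (forall i, depth h i = depth g i) ->
    avoids_hull (positive_set (h i)) (positive_set (fun y => \sum_(j | P j) h j y)).
  move=> ch curth hg y1 z y2 h1 h2 hz yzy.
  have [j Pj hj] : exists2 j, P j & 0 < h j z.
    apply: contrapT => nex; move: hz; rewrite /positive_set/= big1 ?ltxx// => j Pj.
    apply/eqP; rewrite eq_le pos// andbT leNgt; apply/negP => hj.
    by apply: nex; exists j.
  have /andP[/eqP ji] := Pj; rewrite leqNgt => /negP; apply.
  rewrite -!hg; apply: depth_lt => //; apply/insideP; split=> //.
  by exists y1, z, y2.
apply: (@density_unique _ l2 (second_mean I_open l2I l2_mean) (g i) (g' i)
  (fun y => \sum_(j | P j) g j y) (fun y => \sum_(j | P j) g' j y)).
- exact: dg.
- exact: dg'.
- by move=> y; apply: sumr_ge0 => j _; exact: pos.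
- by move=> y; apply: sumr_ge0 => j _; exact: pos.
- have all_lower : {ae l2, forall y, forall j,
      (depth g j < depth g i)%N -> g j y = g' j y}.
    apply: filter_forall => j.
    have [ji|_] := boolP (depth g j < depth g i)%N; last exact: aeW.
    by apply: filterS (lower j ji) => y ->.
  apply: filterS3 g1 g1' all_lower => y.
  have split_sum (h : 'I_n -> R -> R) : \sum_j h j y =
      h i y + \sum_(j | P j) h j y + \sum_(j | (depth g j < depth g i)%N) h j y.
    rewrite (bigID (fun j => (depth g j < depth g i)%N))/= addrC; congr (_ + _).
    rewrite (bigD1 i) ?ltnn//=; congr (_ + _); apply: eq_bigl => j.
    by rewrite -leqNgt andbC.
  rewrite !split_sum => e e' low; move: e; rewrite -e'.
  rewrite [X in _ + X](eq_bigr (fun j => g' j y)) => [/addIr//|j]; exact: low.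
- by apply: avoids.
- by apply: avoids => // j; rewrite gg'.
- by rewrite mass_g mass_g'.
- by rewrite mean_g mean_g'.
Qed.

(** Each depth function belongs to at most one curtain transport, by [curtain_density_unique].
    Picking it with [xget] places C in the range of a map on a finite type. *)
Lemma finite_curtain : finite_set C.
Proof.
have [->|/set0P[nu0 Cnu0]] := eqVneq C set0; first exact: finite_set0.
pose Q (k : {ffun 'I_n -> 'I_n.+1}) := [set nu | C nu /\ exists g,
  [/\ forall i, density (g i), represents l2 a nu g, curtain_density g &
      forall i, depth g i = k i]].
apply: (@sub_finite_set _ _ (range (fun k => xget nu0 (Q k)))); last first.
  by apply: finite_image; exact: finite_finset.
move=> nu Cnu; have [g [dg repr curt]] := curtain_density_of Cnu.
exists [ffun i => depth g i] => //; apply: xget_subset1.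
  by split=> //; exists g; split=> // i; rewrite ffunE.
move=> nu1 nu2 [[M1 _] [g1 [dg1 repr1 curt1 k1]]] [[M2 _] [g2 [dg2 repr2 curt2 k2]]].
apply: (represents_unique I_open l1I a_inj l1_supp M1 M2 dg1 dg2 repr1 repr2) => i.
apply: curtain_density_unique => //.
- exact: (represents_coupling I_open l1I a_inj l1_supp M1 dg1 repr1).
- exact: (represents_coupling I_open l1I a_inj l1_supp M2 dg2 repr2).
- by move=> j; rewrite k1 k2.
Qed.

End curtain_densities.

(** * Convex hull of the vectors of curtain transports *)

Section curtain_hull.
Context {R : realType} (I : set R) (l1 l2 : probability R R).
Context (n : nat) (a : 'I_n -> R) (f : R -> R).
Hypotheses (I_open : open I) (I_itv : is_interval I) (I_neq0 : I !=set0).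
Hypotheses (l1I : l1 I = 1%E) (l2I : l2 I = 1%E).
Hypotheses (l1_mean : finite_mean I l1) (l2_mean : finite_mean I l2).
Hypotheses (a_inj : injective a) (l1_supp : support_in I l1 = range a).
Hypothesis f_concave : concave_on I f.
Hypothesis f_neg : (\int[l2]_(x in I) (f^\- x)%:E < +oo)%E.
Implicit Types (nu : probability (R * R)%type R) (g : 'I_n -> R -> R).

Local Notation p := (atom_mass l1 a).
Local Notation M := (martingale_transport I l1 l2).
Local Notation C := (curtain_transport I l1 l2).
Local Notation v := (cond_means I f a).

Let l2_id := second_mean I_open l2I l2_mean.
Let finC := finite_curtain I_open l1I l2I l2_mean a_inj l1_supp.

Let restrict_oppE y : ((fun x => - f x) \_ I) y = - (f \_ I) y.
Proof. by rewrite /patch; case: ifP => // _; rewrite oppr0. Qed.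

Let oppf1 : l2.-integrable setT (EFin \o (fun x => - f x) \_ I).
Proof. exact: (convex_integrable l2_id I_open I_itv I_neq0 f_concave f_neg). Qed.

Let f1 : l2.-integrable setT (EFin \o f \_ I).
Proof.
have := L1N oppf1; apply: eq_integrable => // y _ /=.
by rewrite restrict_oppE opprK.
Qed.

Let p_gt0 i : 0 < p i.
Proof. exact: (atom_mass_gt0 I_open l1I a_inj l1_supp). Qed.

Let vE nu g i : M nu -> (forall i, density (g i)) -> represents l2 a nu g ->
  v nu ord0 i = (p i)^-1 * \int[l2]_y ((f \_ I) y * g i y).
Proof.
move=> Mnu dg repr.
exact: (represents_cond_means I_open l1I l2I a_inj l1_supp Mnu (dg i) repr f1).
Qed.

(** Maximizing with f is minimizing with the convex function -f, which the greedy densities do for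
    maxima of affine functions and hence, by approximation, for -f. *)
Lemma curtain_dominates nu (w : 'I_n -> R) : M nu -> exists nu',
  C nu' /\ \sum_i w i * v nu ord0 i <= \sum_i w i * v nu' ord0 i.
Proof.
move=> Mnu.
have [g0 [dg0 repr0]] := represents_ex I_open l1I a_inj l1_supp Mnu.
have cg0 := represents_coupling I_open l1I a_inj l1_supp Mnu dg0 repr0.
(* The coordinates of [v nu] are integrals against [g i] divided by [p i]; the weights absorb this
   factor. *)
pose u i := w i / p i.
have [g [cg curt dom]] := curtain_density_ex l2_id p_gt0 u cg0.
have dg i : density (g i) by have [] := cg.
have [nu' [Mnu' repr]] := transport_of_coupling
  I_open l1I l2I l1_mean l2_mean a_inj l1_supp cg.
exists nu'; split.
  exact: (curtain_of_density I_open l1I l2I a_inj l1_supp Mnu' dg repr curt).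
have := convex_dominates l2_id I_open I_itv I_neq0 l2I f_concave oppf1 dg dg0
  (fun phi pphi => dom phi g0 pphi cg0).
have opp h : density h -> \int[l2]_y (((fun x => - f x) \_ I) y * h y) =
    - \int[l2]_y ((f \_ I) y * h y).
  move=> [mh h01]; rewrite -mulN1r -RintegralZl//; last exact: L1M.
  by apply: eq_Rintegral => y _; rewrite restrict_oppE mulN1r mulNr.
have sum_opp h : (forall i, density (h i)) ->
    \sum_i u i * \int[l2]_y (((fun x => - f x) \_ I) y * h i y) =
    - \sum_i u i * \int[l2]_y ((f \_ I) y * h i y).
  by move=> dh; rewrite -sumrN; apply: eq_bigr => i _; rewrite opp// mulrN.
rewrite sum_opp// sum_opp// lerN2; congr (_ <= _); apply: eq_bigr => i _.
  by rewrite (vE _ Mnu dg0 repr0) mulrA.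
by rewrite (vE _ Mnu' dg repr) mulrA.
Qed.

Let s := finmap.enum_fset (fset_set C).

Let sumC (V : nmodType) (F : probability (R * R)%type R -> V) nu0 :
  \sum_(c \in C) F c = \sum_(j < size s) F (nth nu0 s j).
Proof. by rewrite fsbig_finite//= (big_nth nu0) big_mkord. Qed.

Let mem_s nu : (nu \in s) = (nu \in C).
Proof. by rewrite in_fset_set. Qed.

Let C_nth nu0 j : (j < size s)%N -> C (nth nu0 s j).
Proof. by move=> js; apply/set_mem; rewrite -mem_s mem_nth. Qed.

Lemma curtain_convex_combination nu : M nu ->
  exists rho, convex_combination C v rho (v nu).
Proof.
move=> Mnu; have [r [r0 r1 rE]] : exists r : 'I_(size s) -> R,
    [/\ forall j, 0 <= r j, \sum_j r j = 1 &
        v nu = \sum_j r j *: v (nth nu s j)].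
  apply: convex_hull_separation => w.
  have [nu' [Cnu' le_w]] := curtain_dominates w Mnu.
  have nu's : (index nu' s < size s)%N by rewrite index_mem mem_s; exact/mem_set.
  by exists (Ordinal nu's); rewrite /= nth_index// -index_mem.
pose rho c := \sum_(j < size s | nth nu s j == c) r j.
have rhoE (j : 'I_(size s)) : rho (nth nu s j) = r j.
  rewrite /rho (bigD1 j)//= big1 ?addr0// => k /andP[].
  by rewrite nth_uniq//; [move=> /eqP/val_inj -> /eqP|exact: finmap.fset_uniq].
exists rho; split.
- by move=> c _; exact: sumr_ge0.
- by rewrite (sumC _ nu); under eq_bigr do rewrite rhoE.
- by rewrite (sumC _ nu) rE; under [RHS]eq_bigr do rewrite rhoE.
Qed.

(** Since all transports share the masses [p i], mixing densities keeps every condition of a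
    coupling and mixes the vectors [v]. The mixed densities are glued into mu, which is then
    compared with the mixture of measures slice by slice; on non-measurable sets both are 0. *)
Lemma transport_of_convex_combination rho x : convex_combination C v rho x ->
  exists mu : probability (R * R)%type R,
  [/\ forall A, mu A = (\sum_(nu \in C) (rho nu)%:E * nu A)%E, M mu & v mu = x].
Proof.
move=> [rho0 rho1 ->].
(* Weights of sum 1 require C to be nonempty; nu0 is the default element of [nth]. *)
have [nu0 Cnu0] : C !=set0.
  apply: contrapT => /set0P/negP/negPn/eqP C0.
  by move: rho1; rewrite C0 fsbig_set0 => /eqP; rewrite eq_sym oner_eq0.
have /choice[G GP] nu : exists g, C nu ->
    (forall i, density (g i)) /\ represents l2 a nu g.
  have [Cnu|nC] := pselect (C nu); last by exists (fun _ _ => 0).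
  by have [g [dg repr _]] := curtain_density_of I_open l1I a_inj l1_supp Cnu; exists g.
pose c (j : 'I_(size s)) := nth nu0 s j.
have Cc j : C (c j) by exact: C_nth.
have Mc j : M (c j) by have [] := Cc j.
pose r j := rho (c j).
have r0 j : 0 <= r j by exact: rho0.
have r1 : \sum_j r j = 1 by exact: (etrans (esym (sumC rho nu0)) rho1).
pose k j := G (c j).
have dk j i : density (k j i) by exact: (GP _ (Cc j)).1.
have reprk j : represents l2 a (c j) (k j) by exact: (GP _ (Cc j)).2.
have ck j := represents_coupling I_open l1I a_inj l1_supp (Mc j) (dk j) (reprk j).
have k0 j i y : 0 <= k j i y by have [_ /(_ y)/andP[]] := dk j i.
have mk j i : measurable_fun setT (k j i) by case: (dk j i).
pose g i y := \sum_j r j * k j i y.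
have dg i : density (g i).
  split; first by apply: measurable_sum => j; exact: measurable_funM.
  move=> y; apply/andP; split; first by apply: sumr_ge0 => j _; rewrite mulr_ge0.
  rewrite -r1; apply: ler_sum => j _; rewrite ler_piMr//.
  by have [_ /(_ y)/andP[]] := dk j i.
have int_g h i : l2.-integrable setT (EFin \o h) ->
    \int[l2]_y (h y * g i y) = \sum_j r j * \int[l2]_y (h y * k j i y).
  move=> h1; have hk1 j : l2.-integrable setT (EFin \o (fun y => h y * k j i y)).
    by have [? ?] := dk j i; exact: L1M.
  under eq_bigr do rewrite -RintegralZl//.
  rewrite -Rintegral_sum; last by move=> j _; exact: L1Z.
  by apply: eq_Rintegral => y _; rewrite mulr_sumr; apply: eq_bigr => j _; ring.
have cg : coupling_density l2 p a g.
  split=> //.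
  - have all1 : {ae l2, forall y, forall j, \sum_i k j i y = 1}.
      by apply: filter_forall => j; have [] := ck j.
    apply: filterS all1 => y k1; rewrite exchange_big/=.
    by under eq_bigr do rewrite -mulr_sumr k1 mulr1.
  - move=> i; have := int_g (cst 1) i (L1_cst l2 1).
    under eq_Rintegral do rewrite mul1r.
    move=> ->; under eq_bigr => j _.
      under eq_Rintegral do rewrite mul1r.
      have [_ _ -> _] := ck j; over.
    by rewrite -mulr_suml r1 mul1r.
  - move=> i; rewrite (int_g id i l2_id); under eq_bigr => j _.
      have [_ _ _ ->] := ck j; over.
    by rewrite -mulr_suml r1 mul1r.
have [mu [Mmu repr]] := transport_of_coupling
  I_open l1I l2I l1_mean l2_mean a_inj l1_supp cg.
exists mu; split=> //.
- move=> A; rewrite (sumC _ nu0) -/c; have [z0 _ mu1 _ _] := Mmu.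
  have [mA|nmA] := pselect (measurable A); last first.
    rewrite z0// big1// => j _; have [z0j _ _ _ _] := Mc j.
    by rewrite z0j// mule0.
  rewrite (measure_slices I_open l1I a_inj l1_supp mu1 mA).
  under [RHS]eq_bigr => j _.
    have [_ _ c1 _ _] := Mc j.
    rewrite (measure_slices I_open l1I a_inj l1_supp c1 mA) ge0_sume_distrr//.
    over.
  rewrite exchange_big/=; apply: eq_bigr => i _.
  have mS : measurable (slice a A i) by exact: measurable_slice.
  have mkE j : measurable_fun (slice a A i) (fun y => (k j i y)%:E).
    by apply/measurable_EFinP; exact: measurable_funTS.
  have termE j : ((rho (c j))%:E * c j (atom_fiber a i `&` snd @^-1` slice a A i) =
      \int[l2]_(y in slice a A i) ((r j)%:E * (k j i y)%:E))%E.
    rewrite reprk// ge0_integralZl//; last by rewrite lee_fin.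
    by move=> y _; rewrite lee_fin.
  rewrite repr//; under [RHS]eq_bigr do rewrite termE.
  rewrite -ge0_integral_sum//.
  + by apply: eq_integral => y _; rewrite -sumEFin.
  + by move=> j; exact: measurable_funeM.
  + by move=> j y _; rewrite mule_ge0 ?lee_fin.
- apply/rowP => i; rewrite (vE _ Mmu dg repr) (int_g _ _ f1) (sumC _ nu0) summxE.
  rewrite mulr_sumr; apply: eq_bigr => j _.
  by rewrite mxE (vE _ (Mc j) (dk j) (reprk j)) mulrCA.
Qed.

End curtain_hull.

Theorem mainTheorem2 (R : realType) (I : set R)
    (I_open : open I) (I_itv : is_interval I) (I_neq0 : I !=set0)
    (l1 l2 : probability R R) (l1I : l1 I = 1%E) (l2I : l2 I = 1%E)
    (l1_mean : finite_mean I l1) (l2_mean : finite_mean I l2)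
    (l12 : convex_order I l1 l2)
    (f : R -> R) (f_concave : concave_on I f)
    (f_neg : (\int[l2]_(x in I) (f^\- x)%:E < +oo)%E)
    (n : nat) (a : 'I_n -> R) (a_inj : injective a)
    (l1_supp : support_in I l1 = range a)
    (G : 'rV[R]_n -> R) :
  let M := martingale_transport I l1 l2 in
  let C := curtain_transport I l1 l2 in
  let v := cond_means I f a in
  let X := [set v nu | nu in M] in
  let J := fun nu => G (v nu) in
  finite_set C /\
  (forall x, maximizes G X x ->
    (exists rho, convex_combination C v rho x) /\
    (forall rho, convex_combination C v rho x ->
      exists2 mu : probability (R * R)%type R,
        (forall A, mu A = \sum_(nu \in C) (rho nu)%:E * nu A)%E &
        maximizes J M mu)) /\
  (forall x, minimizes G X x ->
    (exists rho, convex_combination C v rho x) /\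
    (forall rho, convex_combination C v rho x ->
      exists2 mu : probability (R * R)%type R,
        (forall A, mu A = \sum_(nu \in C) (rho nu)%:E * nu A)%E &
        minimizes J M mu)).
Proof.
move=> M C v X J.
have combination x : X x -> exists rho, convex_combination C v rho x.
  by move=> [nu Mnu <-]; exact: (curtain_convex_combination I_open I_itv I_neq0).
have transport rho x : convex_combination C v rho x ->
    exists mu : probability (R * R)%type R,
    [/\ forall A, mu A = (\sum_(nu \in C) (rho nu)%:E * nu A)%E, M mu & v mu = x].
  exact: (transport_of_convex_combination I_open I_itv I_neq0).
split; first exact: (finite_curtain I_open l1I l2I l2_mean a_inj l1_supp).
(* The mixture satisfies v mu = x, so J mu = G x, while J of any transport is a value of G on X, to
   which optimality of x applies. *)
split=> x [Xx xopt]; split; try exact: combination.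
  move=> rho /transport[mu [muE Mmu vmu]]; exists mu => //; split=> // nu Mnu.
  by rewrite /J vmu; apply: xopt; exists nu.
move=> rho /transport[mu [muE Mmu vmu]]; exists mu => //; split=> // nu Mnu.
by rewrite /J vmu; apply: xopt; exists nu.
Qed.
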